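(* Let $s=(x_n)$ be a normalized, bimonotone, weakly null sequence in a real Banach space and let $\xi$ be a countable ordinal. There exists $M\in[\mathbb N]$ such that for every $\delta\in(0,1]$ there exists a constant $C(\delta)>0$ with the following property: if $L\in[M]$, $n\in\mathbb N$ and $(a_i)_{i=1}^n$ are scalars in $[-1,1]$, then $$\Big\|\sum_{i\in F}a_i\,\xi_i^L\cdot s\Big\|\le C(\delta)\max\Big\{\delta,\ \Big\|\sum_{i=1}^na_i\,\xi_i^L\cdot s\Big\|\Big\}$$ for all $F\subset\{i\le n:|a_i|\ge\delta\}$.
   Context: Bimonotone: for all finitely supported scalars $(a_i)$ and all $n$, $\max\{\|\sum_{i\le n}a_ix_i\|,\|\sum_{i>n}a_ix_i\|\}\le\|\sum_ia_ix_i\|$. $[M]$ is the set of infinite subsets of $M$, enumerated increasingly $M=(m_n)$. For each countable ordinal $\xi$ fix successor ordinals $(\beta_n(\xi)+1)_n$: equal to $\xi$ if $\xi$ is a successor, strictly increasing to $\xi$ if $\xi$ is a limit. Repeated averages: identify $\ell_1$ with signed measures on $\mathbb N$ with unit vector basis $(e_n)$; for $\mu=\sum a_ne_n$ put $\mu\cdot s=\sum a_nx_n$. For $\xi<\omega_1$ and $M=(m_n)\in[\mathbb N]$ define finitely supported probability measures $\xi_n^M$ by transfinite induction: $0_n^M=e_{m_n}$. If $\xi=\zeta+1$: $\xi_1^M=\frac1{m_1}\sum_{i=1}^{m_1}\zeta_i^M$; given $\xi_n^M$, let $M_n=\{m\in M:m>\max\operatorname{supp}\xi_n^M\}$, $k_n=\min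 M_n$, $\xi_{n+1}^M=\frac1{k_n}\sum_{i=1}^{k_n}\zeta_i^{M_n}$. If $\xi$ is a limit: $\xi_1^M=[\beta_{m_1}(\xi)+1]_1^M$ and $\xi_{n+1}^M=[\beta_{k_n}(\xi)+1]_1^{M_n}$, with $M_n,k_n$ as before ($[\gamma]_1^P$ is the first measure of order $\gamma$ for the set $P$). *)

(* Defs.v *)
From HB Require Import structures.
From mathcomp Require Import all_boot all_order all_algebra.
From mathcomp Require Import all_classical all_reals all_analysis.
Set Implicit Arguments. Unset Strict Implicit. Unset Printing Implicit Defensive.
Import Order.TTheory GRing.Theory Num.Theory.
Import numFieldNormedType.Exports.
Local Open Scope classical_set_scope.
Local Open Scope ring_scope.

(* Countable ordinals as Brouwer trees; a limit node [OL f] carries its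
   fundamental sequence f 0, f 1, ... = (beta_1+1, beta_2+1, ...). *)
Inductive bord := OZ | OS of bord | OL of (nat -> bord).

Inductive ole : bord -> bord -> Prop :=
| ole_Z y : ole OZ y
| ole_S x y : olt x y -> ole (OS x) y
| ole_L f y : (forall n, ole (f n) y) -> ole (OL f) y
with olt : bord -> bord -> Prop :=
| olt_S x y : ole x y -> olt x (OS y)
| olt_L x f n : olt x (f n) -> olt x (OL f).

(* well-formed notation: at limit nodes the fundamental sequence consists of
   successor ordinals and is strictly increasing (so the node is its sup, a limit) *)
Inductive ord_wf : bord -> Prop :=
| wf_Z : ord_wf OZ
| wf_S z : ord_wf z -> ord_wf (OS z)
| wf_L f : (forall n, ord_wf (f n)) -> (forall n, exists b, f n = OS b) ->
           (forall n, olt (f n) (f n.+1)) -> ord_wf (OL f).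

(* infinite subsets of N = {1,2,...} given by their increasing enumeration *)
Definition incr_seq (m : nat -> nat) := forall k, (m k < m k.+1)%N.
Definition subseq_of (l m : nat -> nat) := forall k, exists j, l k = m j.

Section Meas.
Variable R : realType.
(* finitely supported signed measures on N: coefficient list, index j <-> e_j *)
Definition meas := seq R.
Definition unit_m (j : nat) : meas := rcons (nseq j 0) 1.
Definition madd (s t : meas) : meas :=
  mkseq (fun j => nth 0 s j + nth 0 t j) (maxn (size s) (size t)).
Definition mscale (a : R) (s : meas) : meas := map (fun c => a * c) s.
Definition maxsupp (s : meas) : nat := \big[maxn/0%N]_(j < size s | nth 0 s j != 0) (j : nat).
(* (1/k) sum_{i=1}^k g_i, where g i stands for g_{i+1} *)
Definition avg (g : nat -> meas) (k : nat) : meas :=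
  mscale (k%:R)^-1 (foldr madd [::] (map g (iota 0 k))).
(* increasing enumeration of {x in M : x > b} where M is enumerated by m *)
Definition tailM (m : nat -> nat) (b : nat) : nat -> nat :=
  fun k => m (k + count (fun i => m i <= b)%N (iota 0 b.+1))%N.

(* repeated averages: rep xi m n = xi_{n+1}^M, M enumerated by m *)
Fixpoint rep (xi : bord) : (nat -> nat) -> nat -> meas :=
  match xi with
  | OZ => fun m n => unit_m (m n)
  | OS z => fun m => fix go n :=
      match n with
      | 0 => avg (rep z m) (m 0%N)
      | n'.+1 => let M' := tailM m (maxsupp (go n')) in avg (rep z M') (M' 0%N)
      end
  | OL f => fun m => fix go n :=
      match n with
      | 0 => rep (f (m 0%N).-1) m 0
      | n'.+1 => let M' := tailM m (maxsupp (go n')) in rep (f (M' 0%N).-1) M' 0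
      end
  end.

Variable V : normedModType R.
(* mu . s = sum_j mu(j) x_j, where the paper's x_j is x (j-1) *)
Definition mdot (mu : meas) (x : nat -> V) : V :=
  \sum_(j < size mu) nth 0 mu j *: x j.-1.

Definition normalized (x : nat -> V) := forall n, `|x n| = 1.
Definition bimonotone (x : nat -> V) :=
  forall (N : nat) (a : nat -> R) (n : nat),
    Num.max `|\sum_(i < N | (i < n)%N) a i *: x i|
            `|\sum_(i < N | (n <= i)%N) a i *: x i|
    <= `|\sum_(i < N) a i *: x i|.
Definition weakly_null (x : nat -> V) :=
  forall f : V -> R, (forall (c : R) u v, f (c *: u + v) = c * f u + f v) ->
    continuous f -> (fun n => f (x n)) @ \oo --> (0 : R).
End Meas.
Arguments rep {R} xi m n.
Arguments mdot {R V} mu x.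

(* Main.v *)
(* Elton's argument, carried out on blocks. Represent functionals of the dual
   unit ball by their coordinates c j = f (x j). If f is nonnegative on some of
   the blocks, with sum at least lam there, one looks for another g in the dual
   ball with the same properties that is moreover summably small at all points of
   M outside those blocks: evaluating g at the whole sum then gives
   delta * lam <= |y| + 2. The points are killed one after the other, and M is
   obtained by fusion from the following step, in which P is the set generating
   the chosen blocks and q < P is the point to be killed. By Galvin's theorem
   either q can always be killed on some infinite L, or for all q < P in L some
   initial segment of the blocks of P forbids it. In the second case fix P, let q
   run over a long finite set preceding P, and take the shortest of the forbidding
   segments: the functional attached to it, truncated after that segment
   (bimonotonicity), serves for all the other segments as well, so it is large at
   all these q, which contradicts weak nullity by compactness. *)
Require Import Defs.
From HB Require Import structures.
From mathcomp Require Import all_boot all_order all_algebra.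
From mathcomp Require Import all_classical all_reals all_analysis.
From mathcomp Require Import zify ring lra.
Set Implicit Arguments. Unset Strict Implicit. Unset Printing Implicit Defensive.
Import Order.TTheory GRing.Theory Num.Theory.
Import numFieldNormedType.Exports.
Local Open Scope classical_set_scope.
Local Open Scope ring_scope.

(** * The Hahn-Banach theorem *)

Section HahnBanach.
Variables (R : realType) (V : lmodType R).
Implicit Types (p q : V -> R) (u v w : V).

Definition sublinear p :=
  (forall u v, p (u + v) <= p u + p v) /\
  (forall t u, 0 <= t -> p (t *: u) = t * p u).

Lemma sublinear0 p : sublinear p -> p 0 = 0.
Proof. by case=> _ pZ; rewrite -(scale0r 0) pZ // mul0r. Qed.

Lemma sublinear_ge p v : sublinear p -> - p (- v) <= p v.
Proof.
move=> sp; have [pD _] := sp; have := pD v (- v).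
rewrite subrr sublinear0 //; lra.
Qed.

Lemma sublinearP p : (forall u v, p (u + v) <= p u + p v) -> p 0 = 0 ->
  (forall t u, 0 < t -> p (t *: u) <= t * p u) -> sublinear p.
Proof.
move=> pD p0 pZ; split=> // t u; rewrite le_eqVlt => /orP[/eqP <-|t0].
  by rewrite scale0r mul0r.
apply/eqP; rewrite eq_le pZ //=.
have := pZ t^-1 (t *: u); rewrite invr_gt0 t0 scalerA mulVf ?gt_eqF // scale1r.
by move=> /(_ isT); rewrite ler_pdivlMl.
Qed.

(** A pair [(w, r)] in [S] stands for the demand [r <= f w] on a linear functional [f]. *)
Definition cone (S : V -> R -> Prop) :=
  [/\ S 0 0, forall w r w' r', S w r -> S w' r' -> S (w + w') (r + r')
    & forall t w r, 0 < t -> S w r -> S (t *: w) (t * r)].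

(** Take for [q v] the infimum of [p (v + w) - r] over the pairs of [S]. It is finite because
    [r <= p w <= p (v + w) + p (- v)], and the pair [(w, r)] itself bounds [q (- w)]. *)
Lemma sublinear_cone p S : sublinear p -> cone S ->
  (forall w r, S w r -> r <= p w) ->
  exists q, [/\ sublinear q, forall v, q v <= p v
              & forall w r, S w r -> q (- w) <= - r].
Proof.
move=> sp [S0 SD SZ] Sp; have [pD pZ] := sp.
pose E v := [set z | exists w r, S w r /\ z = p (v + w) - r].
have lbE v : lbound (E v) (- p (- v)).
  move=> _ [w [r [Swr ->]]]; have := Sp _ _ Swr.
  by have := pD (v + w) (- v); rewrite addrC addKr; lra.
have leE v w r : S w r -> inf (E v) <= p (v + w) - r.
  by move=> Swr; apply: ge_inf; [exists (- p (- v))|exists w, r].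
have geE v z : (forall w r, S w r -> z <= p (v + w) - r) -> z <= inf (E v).
  move=> h; apply: lb_le_inf; first by exists (p (v + 0) - 0), 0, 0.
  by move=> _ [w [r [Swr ->]]]; exact: h.
exists (fun v => inf (E v)); split.
- apply: sublinearP => [u v||t u t0].
  + suff h w r : S w r -> inf (E (u + v)) - (p (u + w) - r) <= inf (E v).
      rewrite -lerBlDr; apply: geE => w r /h; lra.
    move=> Swr; apply: geE => w' r' Swr'.
    have := leE (u + v) _ _ (SD _ _ _ _ Swr Swr').
    by have := pD (u + w) (v + w'); rewrite addrACA; lra.
  + apply/eqP; rewrite eq_le; apply/andP; split.
      by have := leE 0 _ _ S0; rewrite addr0 sublinear0 // subr0.
    apply: geE => w r /Sp; rewrite add0r; lra.
  + rewrite -ler_pdivrMl //; apply: geE => w r Swr.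
    rewrite ler_pdivrMl //; have := leE (t *: u) _ _ (SZ _ _ _ t0 Swr).
    by rewrite -scalerDr pZ ?(ltW t0) //; lra.
- by move=> v; have := leE v _ _ S0; rewrite addr0 subr0.
- move=> w r Swr; have := leE (- w) _ _ Swr.
  by rewrite addNr sublinear0 // sub0r.
Qed.

(** Zorn's lemma for the pointwise order. A chain is bounded below by its pointwise infimum, finite
    because each member is at least [- p (- v)] at [v]. *)
Lemma minimal_sublinear p : sublinear p ->
  exists q, [/\ sublinear q, forall v, q v <= p v
    & forall q', sublinear q' -> (forall v, q' v <= q v) -> q' = q].
Proof.
move=> sp.
pose P := [set q | sublinear q /\ forall v, q v <= p v].
pose T := {q : V -> R | P q}.
pose r (s t : T) := `[< forall v, sval t v <= sval s v >].
have t0 : T by exists p.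
have [|a b c /asboolP ab /asboolP bc|A totA|[q [sq qp]] qmin] := @ZL_preorder T t0 r.
- by move=> t; apply/asboolP.
- by apply/asboolP => v; exact: le_trans (bc v) (ab v).
- have [[a0 Aa0]|A0] := pselect (exists a, A a); last first.
    by exists t0 => s As; case: A0; exists s.
  pose E v := [set z | exists2 a : T, A a & z = sval a v].
  have leE a v : A a -> inf (E v) <= sval a v.
    move=> Aa; apply: ge_inf; last by exists a.
    exists (- p (- v)) => _ [b Ab ->]; have [sb bp] := svalP b.
    by have := sublinear_ge v sb; have := bp (- v); lra.
  have geE v z : (forall a, A a -> z <= sval a v) -> z <= inf (E v).
    move=> h; apply: lb_le_inf; first by exists (sval a0 v), a0.
    by move=> _ [a Aa ->]; exact: h.
  have Pi : P (fun v => inf (E v)).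
    split; last by move=> v; apply: le_trans (leE _ v Aa0) _; case: (svalP a0).
    apply: sublinearP => [u v||t u t1].
    + suff h a : A a -> inf (E (u + v)) - sval a u <= inf (E v).
        by rewrite -lerBlDr; apply: geE => a /h; lra.
      move=> Aa; apply: geE => b Ab.
      (* The smaller of two members of the chain serves at [u] and at [v] simultaneously, which
         makes the infimum subadditive. *)
      have [c Ac [cu cv]] : exists2 c, A c & sval c u <= sval a u /\ sval c v <= sval b v.
        by case: (totA _ _ Aa Ab) => /asboolP h; [exists b|exists a].
      have [[cD _] _] := svalP c; have := cD u v; have := leE _ (u + v) Ac; lra.
    + apply/eqP; rewrite eq_le; apply/andP; split.
        by have := leE _ 0 Aa0; have [/sublinear0 -> _] := svalP a0.
      by apply: geE => a _; have [/sublinear0 -> _] := svalP a.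
    + rewrite -ler_pdivrMl //; apply: geE => a Aa; rewrite ler_pdivrMl //.
      by have [[_ aZ] _] := svalP a; rewrite -aZ ?(ltW t1) //; exact: leE.
  exists (exist _ _ Pi) => s As; apply/asboolP => v /=; exact: leE.
exists q; split=> // q' sq' q'q.
have Pq' : P q' by split=> // v; exact: le_trans (q'q v) (qp v).
have /qmin /asboolP /= h : r (exist _ q (conj sq qp)) (exist _ q' Pq') by apply/asboolP.
by apply/funext => v; apply/eqP; rewrite eq_le q'q h.
Qed.

(** Apply [sublinear_cone] to the ray of pairs [(t *: u, t * q u)]. The result lies below [q], so it
    is [q] by minimality, and hence [q (- u) <= - q u]. Thus [q] is odd, and an odd sublinear
    function is linear. *)
Lemma minimal_sublinear_linear q : sublinear q ->
  (forall q', sublinear q' -> (forall v, q' v <= q v) -> q' = q) ->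
  forall (t : R) u v, q (t *: u + v) = t * q u + q v.
Proof.
move=> sq qmin; have [qD qZ] := sq.
have qN u : q (- u) = - q u.
  pose S w r := exists t, [/\ 0 <= t, w = t *: u & r = t * q u].
  have cS : cone S.
    split.
    - by exists 0; rewrite scale0r mul0r.
    - move=> _ _ _ _ [t [t0 -> ->]] [t' [t'0 -> ->]]; exists (t + t').
      by rewrite addr_ge0 // scalerDl mulrDl.
    - move=> s _ _ s0 [t [t0 -> ->]]; exists (s * t).
      by rewrite scalerA mulrA mulr_ge0 // ltW.
  have [|q' [sq' q'q q'S]] := sublinear_cone sq cS.
    by move=> _ _ [t [t0 -> ->]]; rewrite qZ.
  have <- := qmin _ sq' q'q.
  have Su : S u (q u) by exists 1; rewrite scale1r mul1r.
  have := q'S _ _ Su; have := sublinear_ge u sq'.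
  by rewrite (qmin _ sq' q'q); lra.
have qA u v : q (u + v) = q u + q v.
  have := qD u v; have := qD (u + v) (- v); rewrite addrK qN; lra.
have qZ' t u : q (t *: u) = t * q u.
  have [t0|t0] := leP 0 t; first exact: qZ.
  by rewrite -[t]opprK scaleNr qN qZ ?oppr_ge0 ?(ltW t0) // !mulNr.
by move=> t u v; rewrite qA qZ'.
Qed.

Lemma hahn_banach_cone p S : sublinear p -> cone S ->
  (forall w r, S w r -> r <= p w) ->
  exists f : V -> R, [/\ forall t u v, f (t *: u + v) = t * f u + f v,
    forall v, f v <= p v & forall w r, S w r -> r <= f w].
Proof.
move=> sp cS Sp; have [q [sq qp qS]] := sublinear_cone sp cS Sp.
have [f [sf fq fmin]] := minimal_sublinear sq.
exists f; split; first exact: minimal_sublinear_linear.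
  by move=> v; exact: le_trans (fq v) (qp v).
move=> w r Swr; have := sublinear_ge w sf; have := fq (- w).
by have := qS _ _ Swr; lra.
Qed.

End HahnBanach.

(** * Open Ramsey theorem *)

Section Sequences.
Local Open Scope nat_scope.
Implicit Types (l m L M P Q : nat -> nat) (w A : seq nat).

Definition nshift k m : nat -> nat := fun i => m (k + i).
Definition splice w Q : nat -> nat :=
  fun i => if i < size w then nth 0 w i else Q (i - size w).

Lemma nshift_nshift j k m : nshift j (nshift k m) = nshift (k + j) m.
Proof. by apply/funext => i; rewrite /nshift addnA. Qed.
Lemma splice_nil Q : splice [::] Q = Q.
Proof. by apply/funext => i; rewrite /splice /= subn0. Qed.
Lemma nshift_splice w Q : nshift (size w) (splice w Q) = Q.
Proof. by apply/funext => i; rewrite /nshift /splice ltnNge leq_addr addKn. Qed.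
Lemma splice_rcons w x Q : splice (rcons w x) Q = splice w (splice [:: x] Q).
Proof.
apply/funext => i; rewrite /splice size_rcons nth_rcons /=.
case: (ltngtP i (size w)) => [h|h|->]; first by rewrite ltnS ltnW.
  by rewrite ltnS leqNgt h /= ltnNge subn_gt0 h /= subnS subn1.
by rewrite ltnSn subnn.
Qed.
Lemma splice_head m : splice [:: m 0] (nshift 1 m) = m.
Proof. by apply/funext => -[|i] //; rewrite /splice /nshift /= subn1. Qed.
Lemma splice_mkseq m k : splice (mkseq m k) (nshift k m) = m.
Proof.
apply/funext => i; rewrite /splice /nshift size_mkseq.
by case: ltnP => h; [rewrite nth_mkseq|rewrite subnKC].
Qed.

Lemma incr_lt m : incr_seq m -> forall i j, i < j -> m i < m j.
Proof.
move=> im i j; elim: j => // j IH; rewrite ltnS leq_eqVlt => /orP[/eqP ->|/IH h].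
  exact: im.
exact: ltn_trans h (im j).
Qed.
Lemma incr_le m : incr_seq m -> forall i j, (m i <= m j) = (i <= j).
Proof.
move=> im i j; have [h|h] := leqP i j.
  case: (ltngtP i j) h => // [ij _|-> _]; last by rewrite leqnn.
  by rewrite ltnW // incr_lt.
by apply/negbTE; rewrite -ltnNge; exact: incr_lt.
Qed.
Lemma incr_ltE m : incr_seq m -> forall i j, (m i < m j) = (i < j).
Proof. by move=> im i j; rewrite !ltnNge incr_le. Qed.
Lemma incr_inj m : incr_seq m -> injective m.
Proof. by move=> im i j h; apply/eqP; rewrite eqn_leq -(incr_le im) -[X in _ && X](incr_le im) h leqnn. Qed.
Lemma incr_ge m : incr_seq m -> forall i, i <= m i.
Proof. by move=> im; elim=> // i IH; exact: leq_ltn_trans IH (im i). Qed.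
Lemma incr_nshift m k : incr_seq m -> incr_seq (nshift k m).
Proof. by move=> im i; rewrite /nshift addnS. Qed.
Lemma subseq_of_refl m : subseq_of m m.
Proof. by move=> k; exists k. Qed.
Lemma subseq_of_trans l m L : subseq_of l m -> subseq_of m L -> subseq_of l L.
Proof. by move=> lm mL k; have [j ->] := lm k; exact: mL. Qed.
Lemma subseq_nshift m k : subseq_of (nshift k m) m.
Proof. by move=> i; exists (k + i). Qed.
#[local] Hint Resolve subseq_of_refl subseq_nshift : core.

Lemma subseq_index l m i j : incr_seq l -> incr_seq m -> subseq_of l m ->
  l i = m j -> i <= j.
Proof.
move=> il im lm; elim: i j => // i IH j e; have [j' e'] := lm i.
by have := il i; rewrite e e' incr_ltE //; apply: leq_ltn_trans; exact: IH.
Qed.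
Lemma subseq_nshift_nshift l m k : incr_seq l -> incr_seq m -> subseq_of l m ->
  subseq_of (nshift k l) (nshift k m).
Proof.
move=> il im lm i; have [j e] := lm (k + i); have h := subseq_index il im lm e.
exists (j - k); rewrite /nshift subnKC //; exact: leq_trans (leq_addr _ _) h.
Qed.
Lemma subseq_after l m i : incr_seq l -> incr_seq m -> subseq_of l m ->
  m i < l 0 -> subseq_of l (nshift i.+1 m).
Proof.
move=> il im lm h k; have [j e] := lm k.
have : m i < m j by rewrite -e; apply: leq_trans h _; rewrite incr_le.
by rewrite incr_ltE // => ij; exists (j - i.+1); rewrite /nshift subnKC.
Qed.

Lemma incr_splice w Q :
  (forall i, i.+1 < size w -> nth 0 w i < nth 0 w i.+1) -> incr_seq Q ->
  (forall i, i < size w -> nth 0 w i < Q 0) -> incr_seq (splice w Q).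
Proof.
move=> iw iQ wQ i; rewrite /splice.
case: (ltnP i.+1 (size w)) => [h|h]; first by rewrite (ltnW h) iw.
case: (ltnP i (size w)) => h'; last by rewrite subSn // iQ.
have -> : i.+1 - size w = 0 by apply/eqP; rewrite subn_eq0.
exact: wQ.
Qed.

Lemma splice_subseq w P M : incr_seq M -> subseq_of P M -> incr_seq P ->
  incr_seq (splice w M) -> incr_seq (splice w P).
Proof.
move=> iM PM iP iwM; have wE i : i < size w -> nth 0 w i = splice w M i.
  by rewrite /splice => ->.
apply: incr_splice => // i hi; first by rewrite !wE ?iwM // ltnW.
have [j ->] := PM 0; rewrite wE //; apply: leq_trans (_ : M 0 <= M j).
  have -> : M 0 = splice w M (size w) by rewrite /splice ltnn subnn.
  exact: incr_lt.
by rewrite incr_le.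
Qed.

Lemma subseq_enum (X : nat -> Prop) m : incr_seq m ->
  (forall b, exists2 i, b <= i & X (m i)) ->
  exists l, [/\ incr_seq l, subseq_of l m & forall i, X (l i)].
Proof.
move=> im Xinf.
have /choice[g gP] : forall b, exists i, b <= i /\ X (m i).
  by move=> b; have [i bi Xi] := Xinf b; exists i.
pose h := fix h n := if n is n'.+1 then g (h n').+1 else g 0.
exists (fun n => m (h n)); split.
- by move=> n; rewrite incr_ltE //=; have [] := gP (h n).+1.
- by move=> n; exists (h n).
- by case=> [|n] /=; [have [] := gP 0|have [] := gP (h n).+1].
Qed.

(* A property of pairs (b, L) that can be achieved by thinning, and survives
   further thinning, can be achieved along one single subsequence m, with b the
   successor of an element of m and L what remains of m after it. *)
Lemma fusion (T : nat -> (nat -> nat) -> Prop) M : incr_seq M ->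
  (forall b L, incr_seq L -> subseq_of L M ->
    exists L', [/\ incr_seq L', subseq_of L' L & T b L']) ->
  (forall b L L', incr_seq L' -> subseq_of L' L -> T b L -> T b L') ->
  exists m, [/\ incr_seq m, subseq_of m M & forall k, T (m k).+1 (nshift k.+1 m)].
Proof.
move=> iM Tdense Tsub.
(* The next set avoids the first point of [L], so that the first points of the successive sets
   increase strictly; they will form [m]. *)
have step L : exists L', incr_seq L -> subseq_of L M ->
    [/\ incr_seq L', subseq_of L' (nshift 1 L) & T (L 0).+1 L'].
  have [[iL LM]|h] := pselect (incr_seq L /\ subseq_of L M); last first.
    by exists L => iL LM; case: h.
  have [L' h'] := Tdense (L 0).+1 _ (incr_nshift 1 iL)
    (subseq_of_trans (subseq_nshift L 1) LM).
  by exists L'.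
have [g gP] := choice step.
pose S := fix S n := if n is n'.+1 then g (S n') else M.
have SP n : incr_seq (S n) /\ subseq_of (S n) M.
  elim: n => [|n [iS SM]] //=; have [iL LS _] := gP _ iS SM; split=> //.
  exact: subseq_of_trans LS (subseq_of_trans (subseq_nshift _ _) SM).
have SS n k : subseq_of (S (k + n)) (S n).
  elim: k => // k IH; have [iS SM] := SP (k + n); have [_ LS _] := gP _ iS SM.
  exact: subseq_of_trans LS (subseq_of_trans (subseq_nshift _ _) IH).
have im : incr_seq (fun n => S n 0).
  move=> n; have [iS SM] := SP n; have [_ LS _] := gP _ iS SM.
  by have [j /= ->] := LS 0; exact: incr_lt.
exists (fun n => S n 0); split=> //.
  by move=> n; have [_] := SP n; exact.
move=> k; have [iS SM] := SP k; have [_ _] := gP _ iS SM; apply: Tsub.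
  exact: (@incr_nshift _ k.+1 im).
by move=> i; rewrite /nshift addnC; exact: (SS k.+1 i).
Qed.

Lemma thin_finite (C : eqType) (s : seq C) (T : C -> (nat -> nat) -> Prop) M :
  incr_seq M ->
  (forall c L, incr_seq L -> subseq_of L M ->
    exists L', [/\ incr_seq L', subseq_of L' L & T c L']) ->
  (forall c L L', incr_seq L' -> subseq_of L' L -> T c L -> T c L') ->
  exists L, [/\ incr_seq L, subseq_of L M & forall c, c \in s -> T c L].
Proof.
move=> iM Tdense Tsub; elim: s => [|c s [L [iL LM Ls]]]; first by exists M.
have [L' [iL' L'L TL']] := Tdense c L iL LM.
exists L'; split=> [//||c']; first exact: subseq_of_trans L'L LM.
by rewrite inE => /orP[/eqP ->//|/Ls]; exact: Tsub.
Qed.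

(** One number bounds both length and entries, so that finitely many lists are concerned and one
    stage of a fusion can treat them all. *)
Definition bounded b A := (size A <= b) && all (fun a => a <= b) A.

Fixpoint lists_upto b n : seq (seq nat) :=
  if n is n'.+1 then [::] :: [seq a :: A | a <- iota 0 b.+1, A <- lists_upto b n']
  else [:: [::]].

Lemma mem_lists_upto b n A : size A <= n -> all (fun a => a <= b) A ->
  A \in lists_upto b n.
Proof.
elim: n A => [|n IH] [|a A] // sA /andP[ab Ab].
rewrite inE; apply/orP; right; apply/allpairsPdep; exists a, A; split=> //.
  by rewrite mem_iota.
exact: IH.
Qed.

Lemma bounded_mem b A : bounded b A -> A \in lists_upto b b.
Proof. by case/andP; exact: mem_lists_upto. Qed.

Lemma thin_bounded b (T : seq nat -> (nat -> nat) -> Prop) M : incr_seq M ->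
  (forall A L, incr_seq L -> subseq_of L M ->
    exists L', [/\ incr_seq L', subseq_of L' L & T A L']) ->
  (forall A L L', incr_seq L' -> subseq_of L' L -> T A L -> T A L') ->
  exists L, [/\ incr_seq L, subseq_of L M & forall A, bounded b A -> T A L].
Proof.
move=> iM Td Ts; have [L [iL LM LT]] := thin_finite (lists_upto b b) iM Td Ts.
by exists L; split=> // A /bounded_mem; exact: LT.
Qed.

Lemma fusion_bounded (T : nat -> seq nat -> (nat -> nat) -> Prop) M : incr_seq M ->
  (forall b A L, incr_seq L -> subseq_of L M ->
    exists L', [/\ incr_seq L', subseq_of L' L & T b A L']) ->
  (forall b A L L', incr_seq L' -> subseq_of L' L -> T b A L -> T b A L') ->
  exists m, [/\ incr_seq m, subseq_of m M &
    forall k A, bounded (m k).+1 A -> T (m k).+1 A (nshift k.+1 m)].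
Proof.
move=> iM Td Ts.
apply: (fusion (T := fun b L => forall A, bounded b A -> T b A L)) => //.
- move=> b L iL LM; apply: thin_bounded => // [A L' iL' L'L|A L1 L2]; last exact: Ts.
  by apply: Td => //; exact: subseq_of_trans LM.
- by move=> b L L' iL' L'L h A /h; exact: Ts.
Qed.

Lemma bounded_max A : exists b, bounded b A.
Proof.
elim: A => [|a A [b /andP[h1 h2]]]; first by exists 0.
exists (maxn a b.+1); rewrite /bounded /= leq_maxl !leq_max ltnS h1 orbT /=.
by apply: sub_all h2 => c h; rewrite /= leq_max (leqW h) orbT.
Qed.

(** * Accepting and rejecting finite sets *)

Section Galvin.
Variable X : (nat -> nat) -> Prop.

Definition accepts A M := forall P, incr_seq P -> subseq_of P M -> X (splice A P).

Lemma accepts_sub A L M : subseq_of L M -> accepts A M -> accepts A L.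
Proof. by move=> LM h P iP PL; apply: h => //; exact: subseq_of_trans LM. Qed.

(* Galvin's lemma in its topological form: open sets of sequences are Ramsey. *)
Theorem open_ramsey M : incr_seq M ->
  (forall P, incr_seq P -> X P -> exists K, forall Q, X (splice (mkseq P K) Q)) ->
  exists L, [/\ incr_seq L, subseq_of L M &
    (forall P, incr_seq P -> subseq_of P L -> X P) \/
    (forall P, incr_seq P -> subseq_of P L -> ~ X P)].
Proof.
move=> iM Xopen.
(* Rejection speaks of all infinite subsets, so that it is hereditary like acceptance. A first
   fusion makes the tails of [m] decide every list bounded in terms of the preceding point. *)
pose rej A L := forall L', incr_seq L' -> subseq_of L' L -> ~ accepts A L'.
have [m [im mM mP]] : exists m, [/\ incr_seq m, subseq_of m M &
    forall k A, bounded (m k).+1 A -> accepts A (nshift k.+1 m) \/ rej A (nshift k.+1 m)].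
  apply: (fusion_bounded (T := fun _ A L => accepts A L \/ rej A L)) => //.
  - move=> _ A L iL LM.
    have [[L' [iL' L'L aL']]|h] :=
      pselect (exists L', [/\ incr_seq L', subseq_of L' L & accepts A L']).
      by exists L'; split=> //; left.
    by exists L; split=> //; right=> L' iL' L'L aL'; apply: h; exists L'.
  - move=> _ A L L' iL' L'L [aL|rL]; [left; exact: accepts_sub aL|right].
    by move=> L2 iL2 L2L'; apply: rL => //; exact: subseq_of_trans L'L.
have rejm k A : rej A (nshift k m) -> rej A m.
  move=> rA L iL Lm aL; apply: (rA (nshift k L)).
  - exact: incr_nshift.
  - exact: subseq_nshift_nshift.
  - exact: accepts_sub aL.
have [[k ak]|nak] := pselect (exists k, accepts [::] (nshift k m)).
  exists (nshift k m); split; first exact: incr_nshift.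
    exact: subseq_of_trans mM.
  by left=> P iP Pm; rewrite -[P]splice_nil; exact: ak.
have rej0 : rej [::] m.
  have [b0|r] := mP 0 [::] isT; last exact: rejm r.
  by case: nak; exists 1.
(* Second fusion: a rejected list remains rejected when a later point of [m'] is added. *)
have [m' [im' m'm m'P]] : exists m', [/\ incr_seq m', subseq_of m' m &
    forall k A, bounded (m' k).+1 A -> rej A m -> forall j, rej (rcons A (nshift k.+1 m' j)) m].
  apply: (fusion_bounded (T := fun _ A L => rej A m -> forall j, rej (rcons A (L j)) m)) => //.
  - move=> _ A L iL Lm; have [rA|nrA] := pselect (rej A m); last by exists L.
    have [[b hb]|h] :=
        pselect (exists b, forall i, b <= i -> rej (rcons A (L i)) m).
      exists (nshift b L); split=> //; first exact: incr_nshift.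
      by move=> _ j; apply: hb; rewrite leq_addr.
    (* Otherwise infinitely many points extend [A] to a list that is not rejected, hence accepted by
       a tail of [m]; the set of these points would accept [A]. *)
    have [c cA] := bounded_max A.
    have [|L' [iL' L'L L'P]] :=
        @subseq_enum (fun v => c <= v /\ ~ rej (rcons A v) m) L iL.
      move=> b; apply: contrapT => hb; apply: h; exists (maxn b c) => i.
      rewrite geq_max => /andP[bi ci]; apply: contrapT => nr; apply: hb.
      exists i => //; split=> //; exact: leq_trans ci (incr_ge iL i).
    exfalso; apply: (rA L') => //; first exact: subseq_of_trans Lm.
    move=> P iP PL'; have PL := subseq_of_trans PL' L'L; have Pm := subseq_of_trans PL Lm.
    have [j ej] := PL' 0; have [cj nrj] := L'P j; have [i ei] := Pm 0.
    rewrite -[P]splice_head -splice_rcons.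
    have [|a|r] := mP i (rcons A (P 0)).
    - rewrite /bounded size_rcons all_rcons; move: cA => /andP[h1 h2].
      rewrite ltnS -ei leqnSn /= (leq_trans h1) ?ej //=.
      by apply: sub_all h2 => a ha; rewrite leqW // (leq_trans ha).
    - apply: a; first exact: incr_nshift.
      apply: subseq_after => //; first exact: incr_nshift.
        exact: subseq_of_trans Pm.
      by rewrite -ei; exact: iP.
    - by case: nrj; rewrite -ej; exact: rejm r.
  - by move=> _ A L L' iL' L'L h rA j; have [i ->] := L'L j; exact: h.
exists (nshift 1 m'); split; first exact: incr_nshift.
  exact: subseq_of_trans (subseq_of_trans m'm mM).
(* By induction all initial segments of [P] are rejected, whereas openness makes the one of length
   [K] accepted by every set. *)
right=> P iP Pm' XP; have [K KP] := Xopen P iP XP.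
have rejP k : rej (mkseq P k) m.
  elim: k => // k IH; rewrite mkseqS.
  have [i ei] := Pm' k; have ki : k <= i by apply: subseq_index ei => //; exact: incr_nshift.
  rewrite ei; have := m'P i (mkseq P k) _ IH 0; rewrite /nshift addn0; apply.
  rewrite /bounded size_mkseq (leqW (leq_trans ki (incr_ge im' i))) /=.
  apply/allP => v /mapP[j]; rewrite mem_iota => /andP[_ jk] ->.
  have [i' ei'] := Pm' j; have : P j < P k by exact: incr_lt.
  by rewrite ei ei' /nshift incr_ltE // => h; rewrite leqW // incr_le.
exact: (rejP K P iP (subseq_of_trans (subseq_of_trans Pm' (subseq_nshift m' 1)) m'm) (fun Q _ _ => KP Q)).
Qed.
End Galvin.
End Sequences.

(** * Repeated averages as blocks *)

Section BlockLengths.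
Local Open Scope nat_scope.
Implicit Types (l : (nat -> nat) -> nat) (m P Q : nat -> nat).

(** Here [l] measures the first block of a set. When first blocks are cut off repeatedly, block
    number [n] (counted from 0) starts at index [ends l m n] of [m]. *)
Fixpoint ends l m n : nat :=
  if n is n'.+1 then (ends l m n' + l (nshift (ends l m n') m))%N else 0%N.

(* blen xi m is the number of elements of M in the support of xi_1^M; the .-1.+1
   keeps it positive for the junk value m 0 = 0. *)
Fixpoint blen (xi : bord) : (nat -> nat) -> nat :=
  match xi with
  | OZ => fun _ => 1
  | OS z => fun m => ends (blen z) m (m 0).-1.+1
  | OL f => fun m => blen (f (m 0).-1) m
  end.

Lemma ends_add l m i j :
  ends l m (i + j) = ends l m i + ends l (nshift (ends l m i) m) j.
Proof.
elim: j => [|j IH]; first by rewrite !addn0.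
by rewrite addnS /= IH addnA nshift_nshift.
Qed.

Lemma ends_lt l m : (forall P, 0 < l P) -> incr_seq (ends l m).
Proof. by move=> l0 n /=; rewrite -[X in X < _]addn0 ltn_add2l. Qed.

Lemma blen_gt0 xi m : 0 < blen xi m.
Proof.
elim: xi m => [|z IH|f IH] m //=.
by rewrite addn_gt0 IH orbT.
Qed.

Lemma ends_local l n m m' :
  (forall P Q, (forall i, i < l P -> P i = Q i) -> l Q = l P) ->
  (forall i, i < ends l m n -> m i = m' i) -> ends l m' n = ends l m n.
Proof.
move=> ll; elim: n => //= n IH h.
have e : ends l m' n = ends l m n by apply: IH => i hi; apply: h; rewrite ltn_addr.
rewrite e; congr (_ + _); apply: ll => i hi.
by apply: h; rewrite ltn_add2l.
Qed.

(** The first element, which lies in the block, fixes the number of pieces at a successor and the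
    lower ordinal at a limit; the pieces are local by induction. Locality later gives openness for
    Galvin's theorem and allows blocks to be regrouped. *)
Lemma blen_local xi m m' : (forall i, i < blen xi m -> m i = m' i) ->
  blen xi m' = blen xi m.
Proof.
elim: xi m m' => [|z IH|f IH] m m' h //=.
  have <- : m 0 = m' 0 by apply: h; exact: blen_gt0.
  exact: (@ends_local (blen z) (m 0).-1.+1 m m' IH h).
have <- : m 0 = m' 0 by apply: h; exact: blen_gt0.
exact: IH.
Qed.

Lemma bends_incr xi m : incr_seq (ends (blen xi) m).
Proof. by apply: ends_lt => P; exact: blen_gt0. Qed.

Lemma bends_local xi n m m' : (forall i, i < ends (blen xi) m n -> m i = m' i) ->
  ends (blen xi) m' n = ends (blen xi) m n.
Proof. by apply: ends_local => P Q; exact: blen_local. Qed.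

(** Since [i <= m i], every index with [m i <= b] occurs in [iota 0 b.+1]; for [b = m e.-1] there
    are exactly [e] of them. *)
Lemma tailM_nshift m e : incr_seq m -> 0 < e -> tailM m (m e.-1) = nshift e m.
Proof.
move=> im e0; apply/funext => k; rewrite /tailM /nshift addnC; congr (m (_ + _)).
have h : e <= (m e.-1).+1 by rewrite -[e]prednK // ltnS incr_ge.
rewrite -(subnKC h) iotaD count_cat -[RHS]addn0; congr (_ + _).
  rewrite -[RHS](size_iota 0); apply/eqP; rewrite -all_count; apply/allP => i.
  by rewrite mem_iota add0n => /andP[_ ie]; rewrite incr_le // -ltnS prednK.
apply/eqP; rewrite eqn0Ngt -has_count; apply/hasPn => i.
by rewrite mem_iota add0n => /andP[ei _]; rewrite incr_le // -ltnNge prednK.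
Qed.

End BlockLengths.

(** * Repeated averages as convex combinations *)

Section Blocks.
Variable R : realType.
Implicit Types (mu : meas R) (m P Q : nat -> nat) (xi : bord).

Lemma eq_avg (g g' : nat -> meas R) k :
  (forall i, (i < k)%N -> g i = g' i) -> avg g k = avg g' k.
Proof.
move=> gg'; rewrite /avg; have -> // : map g (iota 0 k) = map g' (iota 0 k).
by apply/eq_in_map => i; rewrite mem_iota add0n => /gg'.
Qed.

(** The same averages as [rep], but with the next block located by block lengths instead of by
    [maxsupp]; [repE] proves the agreement. *)
Fixpoint first xi : (nat -> nat) -> meas R :=
  match xi with
  | OZ => fun m => unit_m R (m 0%N)
  | OS z => fun m => avg (fun i => first z (nshift (ends (blen z) m i) m)) (m 0%N)
  | OL f => fun m => first (f (m 0%N).-1) m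
  end.

Definition blk xi m i := first xi (nshift (ends (blen xi) m i) m).

Lemma blk_nshift xi m i j :
  blk xi m (i + j) = blk xi (nshift (ends (blen xi) m i) m) j.
Proof. by rewrite /blk ends_add nshift_nshift. Qed.

Lemma first_local xi m m' : (forall i, (i < blen xi m)%N -> m i = m' i) ->
  first xi m' = first xi m.
Proof.
elim: xi m m' => [|z IH|f IH] m m' h /=.
- by rewrite h.
- have e : m 0%N = m' 0%N by apply: h; exact: blen_gt0.
  rewrite -e; apply: eq_avg => i im.
  have hi : (ends (blen z) m i.+1 <= blen (OS z) m)%N.
    have -> : blen (OS z) m = ends (blen z) m (m 0%N).-1.+1 by [].
    by rewrite (incr_le (bends_incr z m)); case: (m 0%N) im.
  have le_i := ltnW (bends_incr z m i).
  have ei : ends (blen z) m' i = ends (blen z) m i.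
    by apply: bends_local => k hk; apply: h; exact: leq_trans (leq_trans hk le_i) hi.
  rewrite ei; apply: IH => k hk; apply: h; apply: leq_trans hi.
  by rewrite /= ltn_add2l.
- have <- : m 0%N = m' 0%N by apply: h; exact: blen_gt0.
  exact: IH.
Qed.

Lemma blk_local xi n m m' : (forall i, (i < ends (blen xi) m n)%N -> m i = m' i) ->
  forall j, (j < n)%N -> blk xi m' j = blk xi m j.
Proof.
move=> h j jn; rewrite /blk.
have hj : (ends (blen xi) m j.+1 <= ends (blen xi) m n)%N.
  by rewrite (incr_le (bends_incr xi m)).
rewrite (bends_local (m := m)) => [|i hi].
  by apply: first_local => i hi; apply: h; apply: leq_trans hj; rewrite /= ltn_add2l.
by apply: h; apply: leq_trans hi (leq_trans (ltnW (bends_incr xi m j)) hj).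
Qed.

Definition ev (W : lmodType R) mu (h : nat -> W) : W :=
  \sum_(j < size mu) nth 0 mu j *: h j.

Section Evaluation.
Variable W : lmodType R.
Implicit Type h : nat -> W.

Lemma ev_pad N mu h : (size mu <= N)%N ->
  ev mu h = \sum_(j < N) nth 0 mu j *: h j.
Proof.
move=> muN; rewrite /ev (big_ord_widen N (fun j => nth 0 mu j *: h j)) //.
rewrite [RHS](bigID (fun j : 'I_N => (j < size mu)%N)) /= [X in _ + X]big1 ?addr0 //.
by move=> j; rewrite -leqNgt => hj; rewrite nth_default // scale0r.
Qed.

Lemma ev_unit j h : ev (unit_m R j) h = h j.
Proof.
rewrite (@ev_pad j.+1) ?size_rcons ?size_nseq // big_ord_recr /= big1 ?add0r.
  by rewrite nth_rcons size_nseq ltnn eqxx scale1r.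
by move=> i _; rewrite nth_rcons size_nseq ltn_ord nth_nseq ltn_ord scale0r.
Qed.

Lemma ev_scale a mu h : ev (Defs.mscale a mu) h = a *: ev mu h.
Proof.
rewrite /ev size_map scaler_sumr; apply: eq_bigr => j _.
by rewrite (nth_map 0) // scalerA.
Qed.

Lemma ev_add mu nu h : ev (madd mu nu) h = ev mu h + ev nu h.
Proof.
set N := maxn (size mu) (size nu).
rewrite (@ev_pad N mu) ?leq_maxl // (@ev_pad N nu) ?leq_maxr // -big_split /=.
rewrite (@ev_pad N) ?size_mkseq //; apply: eq_bigr => j _.
by rewrite nth_mkseq // scalerDl.
Qed.

Lemma ev_avg g k h : ev (avg g k) h = k%:R^-1 *: \sum_(i < k) ev (g i) h.
Proof.
rewrite ev_scale; congr (_ *: _).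
rewrite -(big_mkord xpredT (fun i => ev (g i) h)) /index_iota subn0.
elim: (iota 0 k) => [|i s IH] /=; first by rewrite big_nil /ev big_ord0.
by rewrite big_cons ev_add IH.
Qed.

End Evaluation.

Lemma ev_delta mu v : ev mu (fun j => (v == j)%:R : R^o) = nth 0 mu v.
Proof.
rewrite (@ev_pad _ (maxn (size mu) v.+1)) ?leq_maxl //.
have hv : (v < maxn (size mu) v.+1)%N by rewrite leq_maxr.
rewrite (bigD1 (Ordinal hv)) //= eqxx big1 ?addr0 ?[_ *: _]mulr1 // => i ni.
case: eqP => [e|_]; last by rewrite scaler0.
by case/eqP: ni; apply/val_inj.
Qed.

(** Describing a measure by its integrals lets averages be handled by linearity, without coefficient
    lists. Strict positivity will identify the support. *)
Definition weights_of mu (n : nat) m (w : nat -> R) :=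
  [/\ forall k, (k < n)%N -> 0 < w k
    & forall (W : lmodType R) (h : nat -> W), ev mu h = \sum_(k < n) w k *: h (m k)].

Lemma first_weights xi m : (forall i, 0 < m i)%N ->
  exists w, weights_of (first xi m) (blen xi m) m w /\ \sum_(k < blen xi m) w k = 1.
Proof.
elim: xi m => [|z IH|f IH] m m0; last exact: IH.
- rewrite /=; exists (fun=> 1); split; last by rewrite big_ord1.
  by split=> // W h; rewrite ev_unit big_ord1 scale1r.
(* The weights of [n] consecutive blocks are concatenated; each block adds mass 1, so division by
   [m 0] restores a probability measure. *)
- have H n : exists w : nat -> R,
    [/\ forall k, (k < ends (blen z) m n)%N -> 0 < w k,
        \sum_(k < ends (blen z) m n) w k = n%:R
      & forall (W : lmodType R) (h : nat -> W),
          \sum_(i < n) ev (blk z m i) h = \sum_(k < ends (blen z) m n) w k *: h (m k)].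
    elim: n => [|n [w [w0 w1 wE]]].
      by exists (fun=> 0); split=> // [|W h]; rewrite !big_ord0.
    set e := ends (blen z) m n.
    have [w' [[w'0 w'E] w'1]] := IH (nshift e m) (fun i => m0 _).
    exists (fun k => if (k < e)%N then w k else w' (k - e)%N); split.
    + move=> k /= hk; case: ltnP => [/w0//|ke]; apply: w'0.
      by rewrite ltn_subLR.
    + rewrite /= big_split_ord /= -natr1; congr (_ + _).
        by rewrite -w1; apply: eq_bigr => k _; rewrite ltn_ord.
      by rewrite -w'1; apply: eq_bigr => k _; rewrite ltnNge leq_addr /= addKn.
    + move=> W h; rewrite big_ord_recr /= wE big_split_ord /=; congr (_ + _).
        by apply: eq_bigr => k _; rewrite ltn_ord.
      by rewrite w'E; apply: eq_bigr => k _; rewrite ltnNge leq_addr /= addKn.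
  have [w [w0 w1 wE]] := H (m 0%N).
  have -> : blen (OS z) m = ends (blen z) m (m 0%N).
    by rewrite -[in RHS](prednK (m0 0%N)).
  have mR : 0 < ((m 0%N)%:R : R) by rewrite ltr0n.
  exists (fun k => (m 0%N)%:R^-1 * w k); split; first split.
  + by move=> k /w0 wk; rewrite mulr_gt0 ?invr_gt0.
  + move=> W h; rewrite ev_avg wE.
    by rewrite scaler_sumr; apply: eq_bigr => k _; rewrite scalerA.
  + by rewrite -mulr_sumr w1 mulVf // gt_eqF.
Qed.

Lemma weights_nth mu n m w : incr_seq m -> weights_of mu n m w ->
  (forall k, (k < n)%N -> nth 0 mu (m k) = w k) /\
  (forall v, nth 0 mu v != 0 -> exists2 k, (k < n)%N & v = m k).
Proof.
move=> im [w0 wE].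
have e v : nth 0 mu v = \sum_(k < n) w k * (v == m k)%:R.
  by rewrite -ev_delta wE.
split=> [k kn|v].
  rewrite e (bigD1 (Ordinal kn)) //= eqxx mulr1 big1 ?addr0 // => i ni.
  rewrite (inj_eq (incr_inj im)); case: eqP => [ki|]; last by rewrite mulr0.
  by case/eqP: ni; apply/val_inj.
rewrite e => h; apply: contrapT => nh; case/eqP: h; apply: big1 => k _.
case: eqP => [vk|]; last by rewrite mulr0.
by case: nh; exists k.
Qed.

Lemma maxsupp_weights mu n m w : incr_seq m -> (0 < n)%N -> weights_of mu n m w ->
  maxsupp mu = m n.-1.
Proof.
move=> im n0 wmu; have [h1 h2] := weights_nth im wmu; have [w0 _] := wmu.
have hn : (n.-1 < n)%N by rewrite prednK.
have hs : (m n.-1 < size mu)%N.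
  rewrite ltnNge; apply/negP => h; have := w0 _ hn.
  by rewrite -h1 // nth_default // ltxx.
apply/eqP; rewrite eqn_leq; apply/andP; split.
  apply/bigmax_leqP => j /h2[k kn ->].
  by rewrite incr_le // -ltnS prednK.
rewrite /maxsupp; apply: (@bigop.leq_bigmax_cond _ _ (fun j : 'I_(size mu) => j : nat) (Ordinal hs)) => /=.
by rewrite h1 // gt_eqF // w0.
Qed.

Lemma incr_gt0 m : incr_seq m -> (0 < m 0)%N -> forall i, (0 < m i)%N.
Proof. by move=> im m0 i; apply: leq_trans m0 _; rewrite incr_le. Qed.

Lemma blk_weights xi m i : incr_seq m -> (0 < m 0)%N ->
  exists w, weights_of (blk xi m i) (blen xi (nshift (ends (blen xi) m i) m))
      (nshift (ends (blen xi) m i) m) w /\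
    \sum_(k < blen xi (nshift (ends (blen xi) m i) m)) w k = 1.
Proof. by move=> im m0; apply: first_weights => k; exact: (incr_gt0 im m0). Qed.

Lemma maxsupp_blk xi m i : incr_seq m -> (0 < m 0)%N ->
  maxsupp (blk xi m i) = m (ends (blen xi) m i.+1).-1.
Proof.
move=> im m0; have [w [wP _]] := blk_weights xi i im m0.
rewrite (maxsupp_weights _ _ wP); [|exact: incr_nshift|exact: blen_gt0].
by rewrite /nshift /= -[X in (_ + X).-1]prednK ?blen_gt0 // addnS.
Qed.

(** All points of a block carry positive weight, so [maxsupp] is its last point and [tailM] resumes
    exactly at the next block. *)
Lemma repE xi m : incr_seq m -> (0 < m 0)%N -> rep xi m = blk xi m :> (nat -> meas R).
Proof.
elim: xi m => [|z IH|f IH] m im m0; apply/funext => n.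
- rewrite /= /blk /= /nshift; congr (unit_m _ (m _)).
  by rewrite addn0; elim: n => //= n <-; rewrite addn1.
- elim: n => [|n IHn].
    by have -> : rep (OS z) m 0 = avg (rep z m) (m 0%N) by []; rewrite IH.
  have -> : @rep R (OS z) m n.+1 = let M' := tailM m (maxsupp (rep (OS z) m n : meas R)) in
     avg (rep z M') (M' 0%N) by reflexivity.
  rewrite IHn maxsupp_blk // tailM_nshift //; last exact: leq_ltn_trans (leq0n _) (bends_incr (OS z) m n).
  set M := nshift _ m; cbv zeta; rewrite IH //; first exact: incr_nshift.
  exact: (incr_gt0 im m0).
- elim: n => [|n IHn].
    by have -> : rep (OL f) m 0 = rep (f (m 0%N).-1) m 0 by []; rewrite IH.
  have -> : @rep R (OL f) m n.+1 = let M' := tailM m (maxsupp (rep (OL f) m n : meas R)) in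
     rep (f (M' 0%N).-1) M' 0 by reflexivity.
  rewrite IHn maxsupp_blk // tailM_nshift //; last exact: leq_ltn_trans (leq0n _) (bends_incr (OL f) m n).
  set M := nshift _ m; cbv zeta; rewrite IH //; first exact: incr_nshift.
  exact: (incr_gt0 im m0).
Qed.

End Blocks.

(** * Functionals dominated by the norm *)

Section Functionals.
Variables (R : realType) (V : normedModType R).
Implicit Types (f : V -> R) (c : nat -> R).

Definition dual_ball f :=
  (forall t u v, f (t *: u + v) = t * f u + f v) /\ forall v, f v <= `|v|.

Lemma dual_ball0 f : dual_ball f -> f 0 = 0.
Proof.
case=> fl _; have := fl 1 0 0; rewrite scale1r addr0 mul1r => e.
by apply: (addrI (f 0)); rewrite addr0.
Qed.

Lemma dual_ballZ f t u : dual_ball f -> f (t *: u) = t * f u.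
Proof. by move=> cf; rewrite -[t *: u]addr0 cf.1 dual_ball0 // addr0. Qed.

Lemma dual_ballD f u v : dual_ball f -> f (u + v) = f u + f v.
Proof. by move=> cf; have := cf.1 1 u v; rewrite scale1r mul1r. Qed.

Lemma dual_ballN f u : dual_ball f -> f (- u) = - f u.
Proof. by move=> cf; rewrite -scaleN1r dual_ballZ // mulN1r. Qed.

Lemma dual_ball_sum f (I : Type) (s : seq I) (P : pred I) (F : I -> V) :
  dual_ball f -> f (\sum_(i <- s | P i) F i) = \sum_(i <- s | P i) f (F i).
Proof.
move=> cf; apply: (big_morph f) => [u v|]; first exact: dual_ballD.
exact: dual_ball0.
Qed.

Lemma dual_ball_norm f v : dual_ball f -> `|f v| <= `|v|.
Proof.
move=> cf; rewrite ler_norml cf.2 andbT lerNl -dual_ballN //.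
by rewrite -[`|v|]normrN cf.2.
Qed.

Lemma dual_ball_opp f : dual_ball f -> dual_ball (fun v => - f v).
Proof.
move=> cf; split=> [t u v|v]; first by rewrite cf.1 opprD mulrN.
by rewrite -dual_ballN // -[`|v|]normrN cf.2.
Qed.

Lemma dual_ball_continuous f : dual_ball f -> continuous f.
Proof.
move=> cf u; apply/cvgrPdist_lt => e e0.
have /cvgrPdist_lt/(_ e e0) : (fun v : V => v) @ u --> u by exact: cvg_id.
apply: filterS => v; apply: le_lt_trans.
by rewrite -dual_ballN // -dual_ballD // dual_ball_norm.
Qed.

Lemma norm_sublinear : sublinear (fun v : V => `|v|).
Proof.
by split=> [u v|t u t0]; [exact: ler_normD|rewrite normrZ ger0_norm].
Qed.

Lemma norming_dual_ball (y : V) : exists2 f, dual_ball f & f y = `|y|.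
Proof.
pose S (w : V) (r : R) := exists t, [/\ 0 <= t, w = t *: y & r = t * `|y|].
have [| |f [fl fn fS]] := @hahn_banach_cone _ _ _ S norm_sublinear.
- split.
  + by exists 0; rewrite scale0r mul0r.
  + move=> _ _ _ _ [t [t0 -> ->]] [t' [t'0 -> ->]]; exists (t + t').
    by rewrite addr_ge0 // scalerDl mulrDl.
  + move=> s _ _ s0 [t [t0 -> ->]]; exists (s * t).
    by rewrite scalerA mulrA mulr_ge0 // ltW.
- by move=> _ _ [t [t0 -> ->]]; rewrite normrZ ger0_norm.
exists f => //; apply/eqP; rewrite eq_le fn fS //.
by exists 1; rewrite scale1r mul1r.
Qed.

Variable x : nat -> V.

Definition dominated c := exists2 f, dual_ball f & forall j, c j = f (x j).

(** Hahn-Banach extends the functional from the span of the sequence. The criterion tests finitely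
    many coordinates at a time, so domination passes to pointwise limits. *)
Lemma dominatedP c : dominated c <->
  forall N (a : nat -> R), \sum_(i < N) a i * c i <= `|\sum_(i < N) a i *: x i|.
Proof.
split=> [[f cf cE] N a|h].
  apply: le_trans (cf.2 _); rewrite dual_ball_sum //; apply: ler_sum => i _.
  by rewrite dual_ballZ // cE.
pose S (w : V) (r : R) := exists N (a : nat -> R),
  w = \sum_(i < N) a i *: x i /\ r = \sum_(i < N) a i * c i.
have pad (W : lmodType R) (y : nat -> W) N N' (a : nat -> R) : (N <= N')%N ->
    \sum_(i < N) a i *: y i = \sum_(i < N') (if (i < N)%N then a i else 0) *: y i.
  move=> NN'; rewrite (big_ord_widen N' (fun i => a i *: y i)) // big_mkcond.
  by apply: eq_bigr => i _; case: ifP => // _; rewrite scale0r.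
have [| |f [fl fn fS]] := @hahn_banach_cone _ _ _ S norm_sublinear.
- split.
  + by exists 0%N, (fun=> 0); rewrite !big_ord0.
  + move=> _ _ _ _ [N [a [-> ->]]] [N' [a' [-> ->]]].
    exists (maxn N N'), (fun i => (if (i < N)%N then a i else 0) +
                                  (if (i < N')%N then a' i else 0)).
    rewrite (pad _ _ N (maxn N N')) ?leq_maxl // (pad _ _ N' (maxn N N')) ?leq_maxr //.
    have pad' := pad R^o c.
    rewrite -!big_split /=; split; first by apply: eq_bigr => i _; rewrite scalerDl.
    rewrite [X in X + _](pad' N (maxn N N')) ?leq_maxl //.
    rewrite [X in _ + X](pad' N' (maxn N N')) ?leq_maxr // -big_split /=.
    by apply: eq_bigr => i _; rewrite mulrDl.
  + move=> t _ _ _ [N [a [-> ->]]]; exists N, (fun i => t * a i).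
    rewrite scaler_sumr mulr_sumr; split; apply: eq_bigr => i _; first by rewrite scalerA.
    by rewrite mulrA.
- by move=> _ _ [N [a [-> ->]]]; exact: h.
have cf : dual_ball f by [].
(* The demands at [x j] and at its negative together force equality. *)
exists f => // j; have Sj (s : R) : S (s *: x j) (s * c j).
  exists j.+1, (fun i => if i == j then s else 0).
  rewrite !big_ord_recr /= eqxx !big1 ?add0r // => i _; case: eqP => [e|_].
  - by have := ltn_ord i; rewrite e ltnn.
  - by rewrite mul0r.
  - by have := ltn_ord i; rewrite e ltnn.
  - by rewrite scale0r.
have := fS _ _ (Sj 1); have := fS _ _ (Sj (-1)).
rewrite !dual_ballZ // !mul1r !mulN1r lerN2 => h1 h2.
by apply/eqP; rewrite eq_le h1 h2.
Qed.

Lemma dominated_opp c : dominated c -> dominated (fun j => - c j).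
Proof.
by case=> f cf cE; exists (fun v => - f v) => [|j]; [exact: dual_ball_opp|rewrite cE].
Qed.

(** Truncation is moved from [c] to the coefficients [a], where bimonotonicity says that it does not
    increase the norm. *)
Lemma dominated_lt n c : bimonotone x -> dominated c ->
  dominated (fun j => if (j < n)%N then c j else 0).
Proof.
move=> bx /dominatedP h; apply/dominatedP => N a.
have := bx N a n; rewrite ge_max => /andP[+ _]; apply: le_trans.
have -> : \sum_(i < N) a i * (if (i < n)%N then c i else 0) =
          \sum_(i < N) (if (i < n)%N then a i else 0) * c i.
  by apply: eq_bigr => i _; case: ifP; rewrite ?mul0r ?mulr0.
apply: le_trans (h N (fun i => if (i < n)%N then a i else 0)) _.
rewrite [X in _ <= `|X|]big_mkcond le_eqVlt; apply/orP; left; apply/eqP.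
by congr `|_|; apply: eq_bigr => i _; case: ifP; rewrite ?scale0r.
Qed.

Lemma dominated_ge n c : bimonotone x -> dominated c ->
  dominated (fun j => if (n <= j)%N then c j else 0).
Proof.
move=> bx /dominatedP h; apply/dominatedP => N a.
have := bx N a n; rewrite ge_max => /andP[_]; apply: le_trans.
have -> : \sum_(i < N) a i * (if (n <= i)%N then c i else 0) =
          \sum_(i < N) (if (n <= i)%N then a i else 0) * c i.
  by apply: eq_bigr => i _; case: ifP; rewrite ?mul0r ?mulr0.
apply: le_trans (h N (fun i => if (n <= i)%N then a i else 0)) _.
rewrite [X in _ <= `|X|]big_mkcond le_eqVlt; apply/orP; left; apply/eqP.
by congr `|_|; apply: eq_bigr => i _; case: ifP; rewrite ?scale0r.
Qed.

Lemma dominated_le1 c j : normalized x -> dominated c -> `|c j| <= 1.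
Proof. by move=> nx [f cf ->]; rewrite -(nx j) dual_ball_norm. Qed.

Lemma dominated_null c : weakly_null x -> dominated c -> c @ \oo --> (0 : R).
Proof.
move=> wx [f cf cE]; rewrite (_ : c = fun n => f (x n)); last exact/funext.
by apply: wx; [exact: cf.1|exact: dual_ball_continuous].
Qed.

(** Otherwise some dominated [C N] is at least [e] in modulus at [g j] for all [j < N]. By Tychonoff
    these have a cluster point, which is dominated and at least [e] in modulus at every [g j]; as
    [j <= g j], it does not tend to 0. *)
Lemma dominated_uniformly_small (g : nat -> nat) (e : R) :
  normalized x -> weakly_null x -> (forall j, j <= g j)%N -> 0 < e ->
  exists N, forall c, dominated c -> exists2 j, (j < N)%N & `|c (g j)| <= e.
Proof.
move=> nx wx gj e0; apply: contrapT => hN.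
have /choice[C CP] : forall N, exists c, dominated c /\
    forall j, (j < N)%N -> e <= `|c (g j)|.
  move=> N; apply: contrapT => h; apply: hN; exists N => c dc; apply: contrapT => hc.
  apply: h; exists c; split=> // j jN; rewrite leNgt; apply/negP => hj.
  by apply: hc; exists j => //; exact: ltW.
pose T := prod_topology (fun _ : nat => R).
have proj_c j : continuous (fun c : T => c j) by exact: (@proj_continuous nat (fun=> R) j).
have Tc := @tychonoff nat (fun _ => R) (fun=> `[-1, 1]%classic) (fun=> @segment_compact R (-1) 1).
pose F : set_system T := (C : nat -> T) @ \oo.
have [|c [_ clc]] := Tc F _.
  exists 0%N => // N _ j /=; rewrite in_itv /= -ler_norml.
  by apply: dominated_le1 => //; exact: (CP N).1.
have cin (B : set T) : closed B -> F B -> B c.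
  by move=> cB FB; move: clc; rewrite clusterE => /(_ _ FB); rewrite -(closure_id B).1.
have dc : dominated c.
  apply/dominatedP => N a.
  apply: (cin [set c : T | \sum_(i < N) a i * c i <= `|\sum_(i < N) a i *: x i|]).
    apply: (@closed_comp T R (fun c : T => \sum_(i < N) a i * c i) [set r | r <= _]).
      have cs := @continuous_big R 'I_N +%R 0 xpredT (@add_continuous R) T
        (index_enum 'I_N) (fun i (c : T) => a i * c i).
      move=> b _; apply: cs => i _ c'.
      exact: (@cvgM R T _ _ _ _ _ _ (cvg_cst _) (proj_c i c')).
    exact: closed_le.
  by exists 0%N => // n _ /=; have [/dominatedP h _] := CP n; exact: h.
have ce j : e <= `|c (g j)|.
  apply: (cin [set c : T | e <= `|c (g j)|]).
    apply: (@closed_comp T R (fun c : T => `|c (g j)|) [set r | e <= r]).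
      by move=> b _; have := cvg_norm (proj_c (g j) b); apply.
    exact: closed_ge.
  by exists j.+1 => // n /= hn; apply: (CP n).2.
have /cvgrPdist_lt/(_ e e0) [n _ /(_ (g n) (gj n)) /=] := dominated_null wx dc.
by rewrite sub0r normrN ltNge ce.
Qed.

End Functionals.

(** * Killing one coordinate *)

Section Pairing.
Variable R : realType.
Implicit Types  (P : nat -> nat) (mu : meas R).

(** For [c j = f (x j)] this is the value of [f] at [mdot mu x]; the predecessor appears because
    sets start at 1 and [x] at 0. *)
Definition pairing c mu : R := ev mu (fun v => c v.-1 : R^o).

Variable xi : bord.
Local Notation E := (ends (blen xi)).
Local Notation blk P i := (@blk R xi P i).

Lemma pairing_blk P i : incr_seq P -> (0 < P 0)%N -> exists w : nat -> R,
  [/\ forall k, 0 <= w k, \sum_(E P i <= k < E P i.+1) w k = 1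
    & forall c, pairing c (blk P i) = \sum_(E P i <= k < E P i.+1) w k * c (P k).-1].
Proof.
move=> iP P0; have [w [[w0 wE] w1]] := @blk_weights R xi P i iP P0.
have sumE (h : nat -> R) : \sum_(E P i <= k < E P i.+1) h k =
    \sum_(k < blen xi (nshift (E P i) P)) h (E P i + k)%N.
  by rewrite -{1}[E P i]add0n big_addn /= addKn big_mkord; under eq_bigr do rewrite addnC.
exists (fun k => if (E P i <= k < E P i.+1)%N then w (k - E P i)%N else 0); split.
- move=> k; case: ifP => // /andP[h1 h2]; apply/ltW/w0.
  by rewrite ltn_subLR.
- rewrite sumE -w1; apply: eq_bigr => k _.
  by rewrite leq_addr /= ltn_add2l ltn_ord addKn.
- move=> c; rewrite /pairing wE sumE; apply: eq_bigr => k _.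
  by rewrite leq_addr /= ltn_add2l ltn_ord addKn.
Qed.

Lemma eq_pairing P i c c' : incr_seq P -> (0 < P 0)%N ->
  (forall k, (E P i <= k < E P i.+1)%N -> c (P k).-1 = c' (P k).-1) ->
  pairing c (blk P i) = pairing c' (blk P i).
Proof.
move=> iP P0 cc'; have [w [_ _ wE]] := pairing_blk i iP P0.
by rewrite !wE; apply: eq_big_nat => k /cc' ->.
Qed.

Lemma pairing_eq0 P i c : incr_seq P -> (0 < P 0)%N ->
  (forall k, (E P i <= k < E P i.+1)%N -> c (P k).-1 = 0) -> pairing c (blk P i) = 0.
Proof.
move=> iP P0 c0; have [w [_ _ wE]] := pairing_blk i iP P0.
by rewrite wE big_nat big1 // => k /c0 ->; rewrite mulr0.
Qed.

(** Each weight is at most the total mass 1. *)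
Lemma pairing_le P i c (h : nat -> R) : incr_seq P -> (0 < P 0)%N ->
  (forall k, (E P i <= k < E P i.+1)%N -> `|c (P k).-1| <= h k) ->
  `|pairing c (blk P i)| <= \sum_(E P i <= k < E P i.+1) h k.
Proof.
move=> iP P0 ch; have [w [w0 w1 wE]] := pairing_blk i iP P0.
have h0 k : (E P i <= k < E P i.+1)%N -> 0 <= h k.
  by move=> /ch; exact: le_trans.
rewrite wE; apply: le_trans (ler_norm_sum _ _ _) _.
rewrite big_nat [leRHS]big_nat; apply: ler_sum => k hk.
rewrite normrM (ger0_norm (w0 k)) -[leRHS]mul1r; apply: ler_pM => //; last exact: ch.
rewrite -w1 (bigD1_seq k) ?mem_index_iota ?iota_uniq //= lerDl.
by apply: sumr_ge0 => j _; exact: w0.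
Qed.

Lemma pairing_le1 P i c : incr_seq P -> (0 < P 0)%N -> (forall j, `|c j| <= 1) ->
  `|pairing c (blk P i)| <= 1.
Proof.
move=> iP P0 c1; have [w [w0 w1 wE]] := pairing_blk i iP P0.
rewrite wE; apply: le_trans (ler_norm_sum _ _ _) _; rewrite -w1.
by apply: ler_sum => k _; rewrite normrM (ger0_norm (w0 k)) ler_piMr.
Qed.

End Pairing.

Section Killing.
Variables (R : realType) (V : normedModType R) (x : nat -> V) (xi : bord).
Hypotheses (nx : normalized x) (bx : bimonotone x) (wx : weakly_null x).
Implicit Types  (P Q L M m : nat -> nat) (A t : seq nat).
Local Notation E := (ends (blen xi)).
Local Notation blk P i := (@blk R xi P i).
Local Notation half := (2^-1 : R).

(* The list t records the smallness already achieved: its entry at v bounds the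
   coordinate at the point v, and the default entry 0 imposes nothing. *)
Definition admissible P n lam t c :=
  [/\ dominated x c, forall v, `|c v.-1| <= half ^+ nth 0%N t v,
      forall i, (i < n)%N -> 0 <= pairing c (blk P i)
    & lam%:R <= \sum_(i < n) pairing c (blk P i)].

(** The point to be killed is [Q 0]. The set generating the blocks is [A], its part before that
    point, followed by the rest of [Q]. *)
Definition kills A t lam (e : R) L := forall Q, incr_seq Q -> subseq_of Q L ->
  incr_seq (splice A Q) -> (0 < splice A Q 0)%N -> forall n,
  (exists c, admissible (splice A (nshift 1 Q)) n lam t c) ->
  exists2 c, admissible (splice A (nshift 1 Q)) n lam t c & `|c (Q 0%N).-1| <= e.

Lemma admissible_local P P' n lam t c : (forall i, (i < E P n)%N -> P i = P' i) ->
  admissible P n lam t c <-> admissible P' n lam t c.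
Proof.
move=> h; have hb i : (i < n)%N -> blk P' i = blk P i.
  by move=> hi; exact: blk_local h _ hi.
have e : \sum_(i < n) pairing c (blk P' i) = \sum_(i < n) pairing c (blk P i).
  by apply: eq_bigr => i _; rewrite hb.
split=> -[dc ct c0 cl]; split=> // [i hi|].
- by rewrite hb //; exact: c0.
- by rewrite e.
- by rewrite -hb //; exact: c0.
- by rewrite -e.
Qed.

(** Truncation at the first point after [n] blocks keeps the pairings with these blocks and makes
    all later ones 0, so neither the signs nor the sum are spoiled. *)
Lemma admissible_truncate P n n' lam t c : incr_seq P -> (0 < P 0)%N ->
  admissible P n lam t c -> (n <= n')%N ->
  admissible P n' lam t (fun j => if (j < (P (E P n)).-1)%N then c j else 0).
Proof.
move=> iP P0 [dc ct c0 cl] nn'; set c' := fun j => _.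
have iE : incr_seq (E P) by exact: bends_incr.
have lo i : (i < n)%N -> pairing c' (blk P i) = pairing c (blk P i).
  move=> hi; apply: eq_pairing => // k /andP[_ hk].
  have : (P k < P (E P n))%N.
    by rewrite incr_ltE //; apply: leq_trans hk _; rewrite incr_le.
  have := incr_gt0 iP P0 k; rewrite /c' => h1 h2; rewrite ifT //; lia.
have hi i : (n <= i)%N -> pairing c' (blk P i) = 0.
  move=> hi; apply: pairing_eq0 => // k /andP[hk _].
  have : (P (E P n) <= P k)%N.
    by rewrite incr_le //; apply: leq_trans hk; rewrite incr_le.
  by rewrite /c' => h; rewrite ifF //; lia.
split.
- exact: dominated_lt.
- by move=> v; rewrite /c'; case: ifP => // _; rewrite normr0 exprn_ge0 // invr_ge0.
- by move=> i _; have [h|h] := ltnP i n; [rewrite lo // c0|rewrite hi].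
- rewrite -(subnKC nn') big_split_ord /= [X in _ + X]big1 ?addr0.
    by apply: le_trans cl _; apply: ler_sum => i _; rewrite lo.
  by move=> i _; rewrite hi // leq_addr.
Qed.

Lemma exists_kills_below A t lam (e : R) M : 0 < e -> incr_seq M ->
  incr_seq (splice A M) -> (0 < splice A M 0)%N ->
  exists L, [/\ incr_seq L, subseq_of L M & kills A t lam e L].
Proof.
move=> e0 iM iAM AM0.
have M0 : (0 < M 0)%N.
  have -> : M 0%N = splice A M (size A) by rewrite /splice ltnn subnn.
  exact: incr_gt0.
pose X Q := exists n, (exists c, admissible (splice A (nshift 1 Q)) n lam t c) /\
  ~ exists2 c, admissible (splice A (nshift 1 Q)) n lam t c & `|c (Q 0%N).-1| <= e.
have [|L [iL LM [allX|noX]]] := @open_ramsey X M iM.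
- move=> P iP [n [[c ac] nc]]; set P' := splice A (nshift 1 P).
  (* The witness [n] depends only on the first [E P' n] points of [P'] and on the point [P 0]; this
     length covers them. *)
  exists (E P' n).+2 => Q; exists n.
  have hloc i : (i < E P' n)%N ->
      P' i = splice A (nshift 1 (splice (mkseq P (E P' n).+2) Q)) i.
    move=> hi; rewrite /P' /splice /nshift; case: ifP => // _.
    have h : (1 + (i - size A) < (E P' n).+2)%N.
      by rewrite add1n !ltnS; apply: leq_trans (leq_subr _ _) (ltnW hi).
    by rewrite size_mkseq h nth_mkseq.
  have e1 : splice (mkseq P (E P' n).+2) Q 0 = P 0%N.
    by rewrite /splice size_mkseq nth_mkseq.
  split; first by exists c; apply/(admissible_local _ _ _ hloc).
  by rewrite e1 => -[c' /(admissible_local _ _ _ hloc) ac' c'e]; apply: nc; exists c'.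
- exfalso.
  have L0 : (0 < L 0)%N by have [j ->] := LM 0%N; exact: incr_gt0.
  have [|N Nsmall] := @dominated_uniformly_small _ _ x (fun j => (L j).-1) e nx wx _ e0.
    move=> j /=; have : (j < L j)%N; last by lia.
    elim: j => [//|j IH]; exact: leq_ltn_trans IH (iL j).
  (* Each of [L 0], ..., [L N] lies before this one [P], so each can be the point to be killed while
     the blocks stay fixed. *)
  pose P := nshift N.+1 L; pose P' := splice A P.
  have iP : incr_seq P by exact: incr_nshift.
  have iP' : incr_seq P'.
    by apply: (splice_subseq iM _ iP iAM); exact: subseq_of_trans (subseq_nshift _ _) LM.
  have P'0 : (0 < P' 0)%N.
    rewrite /P' /splice; case: ifP => [hA|_]; first by move: AM0; rewrite /splice hA.
    by rewrite sub0n; exact: (incr_gt0 iL L0).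
  have /choice[n nP] : forall j : 'I_N.+1, exists n, (exists c, admissible P' n lam t c) /\
      ~ exists2 c, admissible P' n lam t c & `|c (L j).-1| <= e.
    move=> j; pose Q := splice [:: L j] P.
    have iQ : incr_seq Q.
      apply: incr_splice => [[]//|//|[|//] _] /=.
      by rewrite /P /nshift addn0; apply: incr_lt.
    have QL : subseq_of Q L.
      by case=> [|k]; [exists j|exists (N.+1 + k)%N]; rewrite /Q /splice //= subn1.
    have [n] := allX Q iQ QL.
    by rewrite (nshift_splice [:: L j] P); exists n.
  (* Truncated after the shortest segment, [c] is admissible for every [n j]; being small at some
     [L j], it contradicts the choice of [n j]. *)
  case: (arg_minnP n (erefl : xpredT (ord0 : 'I_N.+1))) => j0 _ minj.
  have [[c ac] _] := nP j0.
  have trunc n' := @admissible_truncate P' (n j0) n' _ _ c iP' P'0 ac.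
  have [dc _ _ _] := trunc _ (leqnn _).
  have [j jN cj] := Nsmall _ dc.
  have [_] := nP (Ordinal (leqW jN)); apply.
  by eexists; [apply: trunc; exact: minj|].
- exists L; split=> // Q iQ QL _ _ n ac; apply: contrapT => nc.
  by apply: (noX Q iQ QL); exists n.
Qed.

Lemma kills_sub A t lam e L L' : subseq_of L' L -> kills A t lam e L -> kills A t lam e L'.
Proof. by move=> L'L h Q iQ QL'; apply: h => //; exact: subseq_of_trans L'L. Qed.

(** Either some subset of [M] can follow [A], and one thins to it first, or there is nothing to
    kill. *)
Lemma exists_kills A t lam (e : R) M : 0 < e -> incr_seq M ->
  exists L, [/\ incr_seq L, subseq_of L M & kills A t lam e L].
Proof.
move=> e0 iM.
have [[Q [iQ QM iAQ AQ0]]|h] := pselect (exists Q,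
  [/\ incr_seq Q, subseq_of Q M, incr_seq (splice A Q) & (0 < splice A Q 0)%N]).
  have [L [iL LQ kL]] := exists_kills_below t lam e0 iQ iAQ AQ0.
  by exists L; split=> //; exact: subseq_of_trans QM.
by exists M; split=> [//||Q iQ QM iAQ AQ0]; [exact: subseq_of_refl|case: h; exists Q].
Qed.

(** At stage [b] only finitely many triples [(A, t, lam)] are bounded by [b], and one thinning
    treats them all. Starting from [succn] keeps the points positive. *)
Lemma exists_fusion : exists m, [/\ incr_seq m, (0 < m 0)%N &
  forall k A t lam, bounded (m k).+1 A -> bounded (m k).+1 t -> (lam <= (m k).+1)%N ->
    kills A t lam (half ^+ (m k).+1) (nshift k.+1 m)].
Proof.
pose T b L := forall A t lam, bounded b A -> bounded b t -> (lam <= b)%N ->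
  kills A t lam (half ^+ b) L.
have iS : incr_seq succn by [].
have [||m [im mS mT]] := @fusion T succn iS.
- move=> b L iL _.
  pose s := [seq (p, lam) | p <- [seq (A, t) | A <- lists_upto b b, t <- lists_upto b b],
                            lam <- iota 0 b.+1].
  have [||L' [iL' L'L L's]] := @thin_finite _ s
      (fun C => kills C.1.1 C.1.2 C.2 (half ^+ b)) L iL.
  + by move=> C L2 iL2 _; apply: exists_kills => //; rewrite exprn_gt0 // invr_gt0.
  + by move=> C L2 L3 _; exact: kills_sub.
  + exists L'; split=> // A t lam bA bt lb; apply: (L's (A, t, lam)).
    apply/allpairsP; exists ((A, t), lam); rewrite mem_iota /= add0n ltnS lb.
    by split=> //; apply/allpairsP; exists (A, t); split=> //; exact: bounded_mem.
- by move=> b L L' _ L'L h A t lam bA bt lb; apply: kills_sub L'L _; exact: h.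
- by exists m; split=> //; have [j ->] := mS 0%N.
Qed.

End Killing.

(** * Killing the complement of a set *)

Section KillAll.
Variables (R : realType) (V : normedModType R) (x : nat -> V) (xi : bord).
Hypotheses (nx : normalized x).
Implicit Types (c : nat -> R) (P Q L M m : nat -> nat) (A t : seq nat).
Local Notation half := (2^-1 : R).
Variable m : nat -> nat.
Hypotheses (im : incr_seq m) (m0 : (0 < m 0)%N).
Hypothesis kill_m : forall k A t lam,
  bounded (m k).+1 A -> bounded (m k).+1 t -> (lam <= (m k).+1)%N ->
  kills x xi A t lam (half ^+ (m k).+1) (nshift k.+1 m).

Lemma half_exp_le i j : (i <= j)%N -> half ^+ j <= half ^+ i.
Proof. by move=> ij; apply: ler_wiXn2l => //; rewrite ?invr_ge0 ?invf_le1 ?ler1n. Qed.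

(** The points of [m] are treated in increasing order, the list [t] handing the bounds already won
    to the next functional. Up to [P 0] the functional [c0] itself serves, since it vanishes
    there. *)
Lemma kill_complement P n lam c0 : incr_seq P -> subseq_of P m -> (lam <= P 0)%N ->
  admissible x xi P n lam [::] c0 -> (forall v, (v < P 0)%N -> c0 v.-1 = 0) ->
  forall k, exists2 c, admissible x xi P n lam [::] c &
    forall j, (j < k)%N -> (forall i, P i <> m j) -> `|c (m j).-1| <= half ^+ j.
Proof.
move=> iP Pm lamP ac0 c00; elim=> [|k [c ac ck]]; first by exists c0.
have [[i0 ei0]|mkP] := pselect (exists i, P i = m k).
  exists c => // j; rewrite ltnS leq_eqVlt => /orP[/eqP -> /(_ i0) //|]; exact: ck.
have [mkP0|P0mk] := ltnP (m k) (P 0%N).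
  exists c0 => // j jk _; rewrite c00 ?normr0 ?exprn_ge0 ?invr_ge0 //.
  by apply: leq_ltn_trans mkP0; rewrite incr_le.
(* At [m 0] nothing is left: [P 0 <= m 0] forces equality. For a later point [m k.+1], the preceding
   [m k] bounds the data. *)
case: k => [|k] in c ac ck mkP P0mk *.
  case: mkP; exists 0%N; apply/eqP; rewrite eqn_leq P0mk /=.
  by have [j ->] := Pm 0%N; rewrite incr_le.
set b := (m k).+1.
(* The first [r] points of [P], those below [m k.+1], become the list [A]. *)
have [r rP rmin] : exists2 r, (m k.+1 < P r)%N & forall i, (i < r)%N -> (P i < m k.+1)%N.
  have ex : exists r, (m k.+1 < P r)%N.
    by exists (m k.+1).+1; exact: incr_ge.
  exists (ex_minn ex); first by case: ex_minnP.
  case: ex_minnP => r _ rmin i ir; rewrite ltn_neqAle; apply/andP; split.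
    by apply/eqP => e; apply: mkP; exists i.
  by rewrite leqNgt; apply/negP => /rmin; rewrite leqNgt ir.
have r0 : (0 < r)%N by case: r rP {rmin} => // h; move: (leq_trans h P0mk); rewrite ltnn.
have Pb i : (i < r)%N -> (P i <= m k)%N.
  move=> /rmin; have [j ->] := Pm i; rewrite incr_ltE // ltnS => jk.
  by rewrite incr_le.
pose A := mkseq P r; pose P' := nshift r P; pose Q := splice [:: m k.+1] P'.
have iP' : incr_seq P' by exact: incr_nshift.
have Q0 : Q 0%N = m k.+1 by [].
have Q1 : nshift 1 Q = P' by exact: (nshift_splice [:: m k.+1]).
have iQ : incr_seq Q.
  by apply: incr_splice => [[]//|//|[|//] _] /=; rewrite /P' /nshift addn0.
have P'm : subseq_of P' (nshift k.+2 m).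
  apply: subseq_after => //; last by rewrite /P' /nshift addn0.
  exact: subseq_of_trans (subseq_nshift _ _) Pm.
have Qm : subseq_of Q (nshift k.+1 m).
  case=> [|i]; first by exists 0%N; rewrite /nshift addn0.
  have [j ej] := P'm i; exists j.+1.
  by rewrite -(addn1 i) addnC -[Q _]/(nshift 1 Q i) Q1 ej /nshift addnS.
have iAQ : incr_seq (splice A Q).
  apply: incr_splice => // i; rewrite size_mkseq => hi.
    by rewrite !nth_mkseq // ltnW.
  by rewrite nth_mkseq // Q0 rmin.
have AQ0 : (0 < splice A Q 0)%N.
  rewrite /splice size_mkseq r0 nth_mkseq //; have [j ->] := Pm 0%N.
  exact: incr_gt0.
have APE : splice A (nshift 1 Q) = P by rewrite Q1; exact: splice_mkseq.
(* A point [m j] killed earlier receives the exponent [j]; all other numbers receive 0, a vacuous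
   demand as coordinates are at most 1. *)
pose X v j := [/\ (j < k.+1)%N, v = m j & forall i, P i <> m j].
pose tau v := if pselect (exists j, X v j) is left h then sval (cid h) else 0%N.
have tauP v : tau v = 0%N \/ X v (tau v).
  by rewrite /tau; case: pselect => [h|_]; [right; case: (cid h)|left].
have tau_m j : X (m j) j -> tau (m j) = j.
  rewrite /tau => h; case: pselect => [h'|h']; last by case: h'; exists j.
  by have [_ /(incr_inj im) <-] := svalP (cid h').
pose t := mkseq tau b.
have tE v : nth 0%N t v = tau v.
  have [h|h] := ltnP v b; first by rewrite nth_mkseq.
  rewrite nth_default ?size_mkseq //; case: (tauP v) => [->//|[h1 h2 _]].
  by move: h; rewrite h2 /b ltnNge incr_le // -ltnS h1.
have bA : bounded b A.
  rewrite /bounded size_mkseq; apply/andP; split.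
    rewrite /b -(prednK r0) ltnS; apply: leq_trans (incr_ge iP r.-1) (Pb _ _).
    by rewrite prednK.
  apply/allP => v /mapP[i]; rewrite mem_iota => /andP[_ ir] ->.
  by rewrite leqW // Pb.
have bt : bounded b t.
  rewrite /bounded size_mkseq leqnn andTb; apply/allP => v /mapP[i _ ->].
  case: (tauP i) => [->//|[h1 _ _]]; rewrite leqW //; move: h1; rewrite ltnS => h1.
  exact: leq_trans h1 (incr_ge im k).
have lb : (lam <= b)%N.
  by rewrite (leq_trans lamP) // leqW // Pb.
have act : admissible x xi P n lam t c.
  case: ac => dc _ c0' cl; split=> // v; rewrite tE.
  case: (tauP v) => [->|[h1 h2 h3]]; first by rewrite expr0 (dominated_le1 _ nx dc).
  by rewrite {1}h2; exact: ck.
have [|c' ac' c'k] := kill_m bA bt lb iQ Qm iAQ AQ0 (n := n).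
  by exists c; rewrite APE.
rewrite APE in ac'; case: ac' => dc' ct' c0' cl'.
exists c' => [|j].
  by split=> // v; rewrite nth_nil expr0 (dominated_le1 _ nx dc').
rewrite ltnS leq_eqVlt => /orP[/eqP -> _|jk nP].
  by apply: le_trans c'k _; apply: half_exp_le; rewrite ltnS incr_ge.
by have := ct' (m j); rewrite tE tau_m.
Qed.

End KillAll.

(** * Sets formed from selected blocks *)

Section Selection.
Variables (R : realType) (xi : bord).
Local Notation E := (ends (blen xi)).
Local Notation blk P i := (@blk R xi P i).
Variables (l : nat -> nat) (n : nat).
Hypotheses (il : incr_seq l).

Definition selection (s : seq nat) : nat -> nat :=
  foldr (fun i Q => splice (mkseq (nshift (E l i) l) (E l i.+1 - E l i)) Q)
    (nshift (E l n) l) s.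

(** A block is determined by its own points, so selected blocks of [l] placed one after another are
    the first blocks of the new set. The appended tail of [l] keeps it infinite and starts after all
    [n] blocks. *)
Lemma selectionP s : sorted ltn s -> all (fun i => i < n)%N s ->
  [/\ incr_seq (selection s), subseq_of (selection s) l,
      selection s 0 = l (E l (head n s)),
      forall k, (k < size s)%N -> blk (selection s) k = blk l (nth 0%N s k)
    & forall i k, (i < n)%N -> i \notin s -> (E l i <= k < E l i.+1)%N ->
        forall j, selection s j <> l k].
Proof.
have iE := bends_incr xi l.
elim: s => [_ _|i s IH /= pi /andP[ni ns]].
  split=> //.
  - exact: incr_nshift.
  - exact: subseq_nshift.
  - by rewrite /= /nshift addn0.
  - move=> i k ni _ /andP[_ hk] j /(incr_inj il) e.
    have : (E l i.+1 <= E l n)%N by rewrite incr_le.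
    by rewrite leqNgt (leq_ltn_trans _ hk) // -e leq_addr.
have [iG Gl G0 Gb Gd] := IH (path_sorted pi) ns.
set w := mkseq _ _; set G := selection s in iG Gl G0 Gb Gd *.
have ihead : (i < head n s)%N by case: s pi {IH ns Gb G iG Gl G0 Gd} => //= a s /andP[].
have sw : size w = blen xi (nshift (E l i) l) by rewrite size_mkseq /= addKn.
have wE k : (k < size w)%N -> nth 0%N w k = l (E l i + k)%N.
  by rewrite size_mkseq => hk; rewrite nth_mkseq.
have wG k : (k < blen xi (nshift (E l i) l))%N -> nshift (E l i) l k = splice w G k.
  by rewrite -sw => hk; rewrite /splice hk wE.
have e1 : E (splice w G) 1 = size w.
  by rewrite sw /= add0n -(blen_local wG).
split.
- apply: incr_splice => // k hk; first by rewrite (wE _ hk) (wE _ (ltnW hk)) addnS.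
  rewrite wE // G0 incr_ltE //; apply: leq_trans (_ : E l i.+1 <= _)%N; last by rewrite incr_le.
  by move: hk; rewrite sw /= ltn_add2l.
- move=> k; rewrite /splice; case: ifP => hk; last exact: Gl.
  by rewrite wE //; exists (E l i + k)%N.
- rewrite /splice; case: ifP => hk; first by rewrite wE // addn0.
  by move: hk; rewrite sw blen_gt0.
- case=> [_|k hk].
    by rewrite [LHS](first_local R wG).
  by rewrite -[k.+1]add1n blk_nshift e1 nshift_splice Gb.
- move=> i' k ni'; rewrite inE negb_or => /andP[/eqP ii' i's] hk j.
  rewrite /splice; case: ifP => hj; last exact: (Gd i' k).
  rewrite wE // => /(incr_inj il) e; move: hj; rewrite sw -(ltn_add2l (E l i)) e => hk'.
  move: hk => /andP[h1 h2]; have h3 : (E l i <= k)%N by rewrite -e leq_addr.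
  have : (E l i < E l i'.+1)%N by exact: leq_ltn_trans h3 h2.
  have : (E l i' < E l i.+1)%N by exact: leq_ltn_trans h1 hk'.
  by rewrite !incr_ltE // !ltnS => h4 h5; apply: ii'; apply/eqP; rewrite eqn_leq h4 h5.
Qed.

End Selection.

(** * The main estimate *)

Lemma sum_half_exp (R : realType) N : \sum_(0 <= k < N) (2^-1 : R) ^+ k <= 2.
Proof.
suff -> : \sum_(0 <= k < N) (2^-1 : R) ^+ k = 2 - 2 * 2^-1 ^+ N.
  by rewrite lerBlDr lerDl mulr_ge0 // exprn_ge0 // invr_ge0.
elim: N => [|N IH]; first by rewrite big_geq // expr0; lra.
by rewrite big_nat_recr //= IH exprS; lra.
Qed.

Lemma sum_consecutive (R : realType) (e : nat -> nat) (h : nat -> R) n :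
  incr_seq e -> e 0%N = 0%N ->
  \sum_(0 <= i < n) \sum_(e i <= k < e i.+1) h k = \sum_(0 <= k < e n) h k.
Proof.
move=> ie e0; elim: n => [|n IH]; first by rewrite e0 !big_geq.
by rewrite big_nat_recr //= IH -big_cat_nat //= ltnW.
Qed.

Lemma sum_below_le (R : realType) n lam (P : pred nat) (h : nat -> R) :
  (forall i, P i -> (i < lam)%N) -> (forall i, h i <= 1) ->
  \sum_(0 <= i < n | P i) h i <= lam%:R.
Proof.
move=> Plam h1; apply: le_trans (_ : \sum_(0 <= i < n | P i) 1 <= _).
  by apply: ler_sum => i _.
rewrite big_const_seq iter_addr_0 -(size_iota 0 lam) ler_nat -size_filter.
apply: uniq_leq_size; first by rewrite filter_uniq // iota_uniq.
by move=> i; rewrite mem_filter mem_iota => /andP[/Plam].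
Qed.

Lemma pairing_opp (R : realType) (c : nat -> R) mu :
  pairing (fun j => - c j) mu = - pairing c mu.
Proof.
by rewrite /pairing /ev -sumrN; apply: eq_bigr => j _; rewrite [LHS]mulrN.
Qed.

Lemma dual_ball_mdot (R : realType) (V : normedModType R) (x : nat -> V) f c
    (mu : meas R) :
  dual_ball f -> (forall j, c j = f (x j)) -> f (mdot mu x) = pairing c mu.
Proof.
move=> cf cE; rewrite dual_ball_sum //; apply: eq_bigr => j _.
by rewrite dual_ballZ // cE.
Qed.

Section LowerBound.
Variables (R : realType) (V : normedModType R) (x : nat -> V) (xi : bord).
Hypotheses (nx : normalized x) (bx : bimonotone x).
Local Notation half := (2^-1 : R).
Local Notation E := (ends (blen xi)).
Local Notation blk P i := (@blk R xi P i).
Variable m : nat -> nat.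
Hypotheses (im : incr_seq m) (m0 : (0 < m 0)%N).
Hypothesis kill_m : forall k A t lam,
  bounded (m k).+1 A -> bounded (m k).+1 t -> (lam <= (m k).+1)%N ->
  kills x xi A t lam (half ^+ (m k).+1) (nshift k.+1 m).

(** The functional given by [kill_complement] is evaluated at the whole sum: the chosen blocks
    contribute at least [delta * lam], all others at least -2. *)
Lemma positive_part_bound l n (a : nat -> R) (p : pred nat) delta lam c :
  incr_seq l -> subseq_of l m -> (forall i, (i < n)%N -> `|a i| <= 1) -> 0 < delta ->
  dominated x c ->
  (forall i, (i < n)%N -> p i -> delta <= a i /\ 0 <= pairing c (blk l i)) ->
  (2 * lam)%:R <= \sum_(0 <= i < n | p i) pairing c (blk l i) ->
  delta * lam%:R <= `|\sum_(i < n) a i *: mdot (blk l i) x| + 2.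
Proof.
move=> il lm a1 d0 dc cp csum.
(* For positive [lam] the selection is nonempty, so [P] will start with a chosen block. *)
case: lam csum => [|lam'] csum; first by rewrite mulr0 addr_ge0.
set lam := lam'.+1 in csum *.
have l0 : (0 < l 0)%N by have [j ->] := lm 0%N; exact: incr_gt0.
have iE := bends_incr xi l.
have lgt k : (k < l k)%N by elim: k => // k IH; exact: leq_ltn_trans IH (il k).
(* Killing requires [lam <= P 0], so blocks starting at or below [lam] are dropped. Their indices
   are below [lam] and each costs at most 1; hence the factor 2 in the hypothesis. *)
pose q i := p i && (lam < l (E l i))%N.
pose s := [seq i <- iota 0 n | q i].
have sE (h : nat -> R) : \sum_(i <- s) h i = \sum_(0 <= i < n | q i) h i.
  by rewrite big_filter /index_iota subn0.
have ssum : lam%:R <= \sum_(i <- s) pairing c (blk l i).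
  rewrite sE; move: csum; rewrite (bigID (fun i => lam < l (E l i))%N) /=.
  have := @sum_below_le R n lam (fun i => p i && ~~ (lam < l (E l i))%N)
    (fun i => pairing c (blk l i)).
  rewrite natrM -/(index_iota 0 n) => h1 h2.
  have h3 := h1 _ _; rewrite /q; suff : \sum_(0 <= i < n | p i && ~~ (lam < l (E l i))%N)
     pairing c (blk l i) <= lam%:R by lra.
  apply: h3 => [i /andP[_]|i]; last first.
    by apply: le_trans (ler_norm _) _; apply: pairing_le1 => // j; exact: dominated_le1 dc.
  rewrite -leqNgt; apply: leq_trans; apply: leq_trans (lgt _); rewrite ltnS.
  exact: incr_ge.
have s_sorted : sorted ltn s by apply: sorted_filter; [exact: ltn_trans|exact: iota_ltn_sorted].
have s_lt : all (fun i => i < n)%N s.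
  by apply/allP => i; rewrite mem_filter mem_iota add0n => /andP[_ /andP[]].
have [iP Pl P0 Pb Pd] := @selectionP R xi l n il s s_sorted s_lt.
set P := selection _ _ _ _ in iP Pl P0 Pb Pd.
have P0lam : (lam < P 0)%N.
  rewrite P0; have : head n s \in s.
    case: (s) ssum => [|i s']; last by rewrite /= inE eqxx.
    by rewrite big_nil lern0.
  by rewrite mem_filter => /andP[/andP[]].
have P0gt : (0 < P 0)%N by exact: leq_ltn_trans P0lam.
pose c1 j := if ((P 0).-1 <= j)%N then c j else 0.
have c1E k : (k < size s)%N -> pairing c1 (blk P k) = pairing c (blk l (nth 0%N s k)).
  move=> ks; rewrite -Pb //; apply: eq_pairing => // i _.
  rewrite /c1 ifT // -!subn1 leq_sub2r // incr_le //.
have ac1 : admissible x xi P (size s) lam [::] c1.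
  have dc1 : dominated x c1 by exact: dominated_ge.
  split=> // [v|k ks|].
  - by rewrite nth_nil expr0 (dominated_le1 _ nx dc1).
  - have : nth 0%N s k \in s by rewrite mem_nth.
    rewrite c1E // mem_filter mem_iota => /andP[/andP[pk _] /andP[_ kn]].
    by case: (cp _ kn pk).
  - apply: le_trans ssum _; rewrite (big_nth 0%N) big_mkord.
    by apply: ler_sum => k _; rewrite c1E.
(* This many steps suffice: a point [m j] in the first [n] blocks of [l] satisfies
   [j <= m j < l (E l n)]. *)
have [|g ag gk] := kill_complement nx im m0 kill_m iP (subseq_of_trans Pl lm) (ltnW P0lam) ac1 _ (l (E l n)).
  move=> v vP; rewrite /c1 ifF //; apply/negbTE; rewrite -ltnNge.
  by rewrite -ltnS (prednK P0gt); case: v vP => // _; exact: leq_ltn_trans P0lam.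
have [[f cf gE] _ g0 gsum] := ag.
pose G i := pairing g (blk l i).
have GP k : (k < size s)%N -> G (nth 0%N s k) = pairing g (blk P k).
  by move=> ks; rewrite Pb.
have qG i : (i < n)%N -> q i -> 0 <= G i.
  move=> ni qi; have si : i \in s by rewrite mem_filter qi mem_iota.
  by rewrite -(nth_index 0%N si) GP ?index_mem // g0 ?index_mem.
have lamG : lam%:R <= \sum_(0 <= i < n | q i) G i.
  apply: le_trans gsum _; rewrite -sE (big_nth 0%N) big_mkord.
  by apply: ler_sum => k _; rewrite GP.
(* A point [l k = m j] of an unselected block lies outside [P], and [k <= j], so the bound at it is
   summable in [k]. *)
have offG i : (i < n)%N -> ~~ q i -> `|a i * G i| <= \sum_(E l i <= k < E l i.+1) half ^+ k.
  move=> ni nqi; rewrite normrM -[leRHS]mul1r; apply: ler_pM => //; first exact: a1.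
  apply: pairing_le => // k hk; have [j ej] := lm k.
  have kj : (k <= j)%N by exact: subseq_index ej.
  apply: le_trans (half_exp_le R kj); rewrite ej; apply: gk; last first.
    by move=> i'; rewrite -ej; apply: (Pd i) => //; rewrite mem_filter negb_and nqi.
  apply: leq_ltn_trans (incr_ge im j) _; rewrite -ej incr_ltE //.
  by case/andP: hk => _ hk; apply: leq_trans hk _; rewrite incr_le.
have fy : f (\sum_(i < n) a i *: mdot (blk l i) x) = \sum_(0 <= i < n) a i * G i.
  rewrite dual_ball_sum // big_mkord; apply: eq_bigr => i _.
  by rewrite dual_ballZ // (dual_ball_mdot _ cf gE).
have := cf.2 (\sum_(i < n) a i *: mdot (blk l i) x); rewrite fy (bigID q) /=.
have on : delta * lam%:R <= \sum_(0 <= i < n | q i) a i * G i.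
  apply: le_trans (_ : delta * \sum_(0 <= i < n | q i) G i <= _).
    by rewrite ler_pM2l.
  rewrite mulr_sumr big_nat_cond [leRHS]big_nat_cond; apply: ler_sum => i.
  move=> /andP[/andP[_ ni] qi]; apply: ler_wpM2r; first exact: qG.
  by move: (qi) => /andP[pi _]; case: (cp _ ni pi).
have off : - 2 <= \sum_(0 <= i < n | ~~ q i) a i * G i.
  rewrite lerNl; apply: le_trans (ler_norm _) _; rewrite normrN.
  apply: le_trans (ler_norm_sum _ _ _) _.
  apply: le_trans (_ : _ <= \sum_(0 <= k < E l n) half ^+ k) (sum_half_exp R _).
  rewrite -(sum_consecutive _ n iE) // [leRHS](bigID q) /= -[leLHS]add0r.
  apply: lerD.
    by apply: sumr_ge0 => i _; apply: sumr_ge0 => k _; rewrite exprn_ge0 // invr_ge0.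
  rewrite big_nat_cond [leRHS]big_nat_cond; apply: ler_sum => i /andP[/andP[_ ni] nq].
  exact: offG.
by move: on off; lra.
Qed.

End LowerBound.

Theorem theorem1p8 (R : realType) (V : completeNormedModType R)
  (x : nat -> V) (xi : bord) :
  normalized x -> bimonotone x -> weakly_null x -> ord_wf xi ->
  exists m : nat -> nat, incr_seq m /\ (0 < m 0%N)%N /\
    forall delta : R, 0 < delta <= 1 ->
    exists C : R, 0 < C /\
      forall (l : nat -> nat), incr_seq l -> subseq_of l m ->
      forall (n : nat) (a : nat -> R), (forall i, (i < n)%N -> `|a i| <= 1) ->
      forall F : {set 'I_n}, (forall i, i \in F -> delta <= `|a i|) ->
        `|\sum_(i in F) a i *: mdot (rep xi l i) x|
          <= C * Num.max delta `|\sum_(i < n) a i *: mdot (rep xi l i) x|.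
Proof.
move=> nx bx wx _.
have [m [im m0 kill_m]] := @exists_fusion R V x xi nx bx wx.
exists m; split=> //; split=> // delta /andP[d0 d1].
have u0 : 0 < delta^-1 by rewrite invr_gt0.
(* With [M] the maximum on the right, [|Y| < 4 * lam + 4], [delta * lam <= M + 2] and
   [1 <= M / delta] combine to this constant. *)
exists (8 * delta^-1 + 8 * delta^-1 ^+ 2); split.
  by rewrite addr_gt0 // mulr_gt0 // exprn_gt0.
move=> l il lm n a a1 F Fd.
have l0 : (0 < l 0)%N by have [j ->] := lm 0%N; exact: incr_gt0.
rewrite repE //; set Y := \sum_(i in F) _; set y := \sum_(i < n) _.
have [f cf fY] := norming_dual_ball Y.
pose c j := f (x j); have dc : dominated x c by exists f.
pose S i := pairing c (blk R xi l i).
have YS : `|Y| = \sum_(i in F) a i * S i.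
  rewrite -fY dual_ball_sum //; apply: eq_bigr => i _.
  by rewrite dual_ballZ // (dual_ball_mdot _ cf (c := c)).
pose inF (i : nat) := [exists j in F, j == i :> nat].
have inFE (i : 'I_n) : inF i = (i \in F).
  apply/existsP/idP => [[j /andP[jF /eqP ji]]|iF]; last by exists i; rewrite iF eqxx.
  by rewrite -(val_inj ji).
have inFd i : inF i -> delta <= `|a i| by move=> /existsP[j /andP[jF /eqP <-]]; exact: Fd.
(* One of the two sums in [Yle] is at least half of [|Y|], hence at least [2 * lam]. *)
pose lam := Num.truncn (`|Y| / 4).
have /andP[lam1 lam2] : lam%:R <= `|Y| / 4 < lam.+1%:R.
  by apply: truncn_itv; rewrite divr_ge0.
(* Only terms in which [a i] and [S i] do not have opposite signs can help, and there [|a i| <= 1]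
   allows the coefficient to be dropped. *)
pose p1 i := [&& inF i, 0 < a i & 0 <= S i].
pose p2 i := [&& inF i, a i < 0 & S i <= 0].
have Yle : `|Y| <= \sum_(0 <= i < n | p1 i) S i + \sum_(0 <= i < n | p2 i) - S i.
  rewrite YS !big_mkord big_mkcond [X in _ <= X + _]big_mkcond [X in _ <= _ + X]big_mkcond.
  rewrite -big_split /=; apply: ler_sum => i _; rewrite /p1 /p2 inFE.
  case: ifP => [iF|_] /=; last by rewrite addr0.
  have := a1 i (ltn_ord i); rewrite ler_norml => /andP[h1 h2].
  by case: (leP 0 (S i)) => h3; case: (leP (S i) 0) => h4; case: (ltgtP (a i) 0) => h5 /=; nra.
have main : delta * lam%:R <= `|y| + 2.
  have [h|h] := leP ((2 * lam)%:R : R) (\sum_(0 <= i < n | p1 i) S i).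
    apply: (positive_part_bound nx bx im m0 kill_m (p := p1) (c := c)) => // i ni.
    by case/and3P => /inFd iF ai Si; rewrite -(gtr0_norm ai).
  (* If the second sum is the large one, both coefficients and functional change sign, while the
     norm of [y] stays the same. *)
  have -> : `|y| = `|\sum_(i < n) - a i *: mdot (blk R xi l i) x|.
    by rewrite -normrN -sumrN; congr `|_|; apply: eq_bigr => i _; rewrite scaleNr.
  apply: (positive_part_bound nx bx im m0 kill_m (a := fun i => - a i) (p := p2)
    (c := fun j => - c j)) => //.
  - by move=> i; rewrite normrN; exact: a1.
  - exact: dominated_opp.
  - move=> i ni /and3P[/inFd iF ai Si].
    by rewrite -(ltr0_norm ai) pairing_opp oppr_ge0.
  - under eq_bigr do rewrite pairing_opp.
    by move: h Yle lam1; rewrite natrM; lra.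
set M := Num.max delta `|y|.
have Md : delta <= M by rewrite le_max lexx.
have My : `|y| <= M by rewrite le_max lexx orbT.
have uM : 1 <= delta^-1 * M by rewrite ler_pdivlMl // mulr1.
have lamM : lam%:R <= delta^-1 * (M + 2 * (delta^-1 * M)).
  rewrite ler_pdivlMl //; lra.
move: lam2; rewrite -[lam.+1%:R]natr1 => lam2.
have -> : (8 * delta^-1 + 8 * delta^-1 ^+ 2) * M =
  4 * (delta^-1 * (M + 2 * (delta^-1 * M))) + 4 * (delta^-1 * M) by ring.
by lra.
Qed.
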